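(* Let $f:[0,1]\to\mathbb{R}^d$ be the self-affine function described in the context, and let $\mathcal{D}(f):=\{t\in(0,1):f'(t)=0\}$ and $\mathcal{D}_\sim(f):=[0,1]\setminus\mathcal{D}(f)$. Assume $\lambda_i<c_i$ for at least one $i\in\{1,\dots,m\}$. (i) If $\sum_{i=1}^m c_i\log(\lambda_i/c_i)\geq 0$, then $\dim_H\mathcal{D}(f)=\beta^*(1)>0$. (ii) If $\sum_{i\in\mathcal{I}_+}c_i^{\hat s}\log(\lambda_i/c_i)\geq 0$, then $\dim_H\mathcal{D}_\sim(f)=\hat s>0$. (iii) If $\sum_{i\in\mathcal{I}_+}c_i^{\hat s}\log(\lambda_i/c_i)<0$, then $\dim_H\mathcal{D}_\sim(f)=\beta^*(1)>0$.
   Context: Setting. Fix integers $d\geq 1$ and $m\geq 2$, let $\mathbf{a}=(0,0,\dots,0)$ and $\mathbf{b}=(1,0,\dots,0)$ in $\mathbb{R}^d$, and fix $\boldsymbol\varepsilon=(\varepsilon_1,\dots,\varepsilon_m)\in\{0,1\}^m$ (the signature). Let $S_1,\dots,S_m$ be contractive similitudes of $\mathbb{R}^d$ with ratios $\lambda_i:=\mathrm{Lip}(S_i)\in[0,1)$ (if $m\geq 3$ one or more $S_i$ may be constant, so $\lambda_i=0$; if $m=2$ all $\lambda_i>0$), satisfying $S_1((1-\varepsilon_1)\mathbf{a}+\varepsilon_1\mathbf{b})=\mathbf{a}$, $S_m(\varepsilon_m\mathbf{a}+(1-\varepsilon_m)\mathbf{b})=\mathbf{b}$, and $S_{i-1}(\varepsilon_{i-1}\mathbf{a}+(1-\varepsilon_{i-1})\mathbf{b})=S_i((1-\varepsilon_i)\mathbf{a}+\varepsilon_i\mathbf{b})$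 for $i=2,\dots,m$. Let $c_1,\dots,c_m>0$ with $\sum_{i=1}^m c_i=1$, put $\sigma_i:=\sum_{j=1}^{i-1}c_j+\varepsilon_ic_i$, $\phi_i(t):=(-1)^{\varepsilon_i}c_it+\sigma_i$, and $I_i:=\phi_i([0,1])$. Then $f:[0,1]\to\mathbb{R}^d$ is the unique continuous function with $f(t)=S_i(f(\phi_i^{-1}(t)))$ for $t\in I_i$, $i=1,\dots,m$. It is assumed throughout that $(\lambda_1,\dots,\lambda_m)\neq(c_1,\dots,c_m)$. Notation. $\mathcal{I}_+:=\{i\in\{1,\dots,m\}:\lambda_i>0\}$ (which has at least two elements). $\hat s$ is the nonnegative number with $\sum_{i\in\mathcal{I}_+}c_i^{\hat s}=1$. For $q\in\mathbb{R}$, $\beta(q)$ is the unique real number with $\sum_{i\in\mathcal{I}_+}\lambda_i^qc_i^{\beta(q)}=1$, and $\beta^*(\alpha):=\inf_{q\in\mathbb{R}}\{\alpha q+\beta(q)\}$ for $\alpha>0$. $\dim_H$ is Hausdorff dimension. Convention: $\log 0:=-\infty$. *)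

(* Defs.v *)
From HB Require Import structures.
From mathcomp Require Import all_boot all_order all_algebra.
From mathcomp Require Import all_classical all_reals all_analysis.
Set Implicit Arguments.
Unset Strict Implicit.
Unset Printing Implicit Defensive.
Import Order.TTheory GRing.Theory Num.Theory.
Import numFieldNormedType.Exports.

Local Open Scope classical_set_scope.
Local Open Scope ring_scope.

(* [`|x|] on row vectors is the sup norm; similitudes need the Euclidean one.
   Continuity and derivatives are unaffected, the two norms being equivalent. *)
Definition enorm (R : realType) (d : nat) (x : 'rV[R]_d) : R :=
  Num.sqrt (\sum_(j < d) x 0 j ^+ 2).

(* [r] is the Lipschitz constant, since [d > 0] where this is used;
   [r = 0] means that [S] is constant. *)
Definition similitude (R : realType) (d : nat)
    (S : 'rV[R]_d -> 'rV[R]_d) (r : R) : Prop :=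
  forall x y, enorm (S x - S y) = r * enorm (x - y).

Definition pta (R : realType) (d : nat) : 'rV[R]_d := 0.

Definition ptb (R : realType) (d : nat) : 'rV[R]_d :=
  \row_(j < d) ((j : nat) == 0%N)%:R.

Definition entry (R : realType) (d : nat) (e : bool) : 'rV[R]_d :=
  (1 - e%:R) *: pta R d + e%:R *: ptb R d.

Definition exit (R : realType) (d : nat) (e : bool) : 'rV[R]_d :=
  e%:R *: pta R d + (1 - e%:R) *: ptb R d.

Section Parametrization.
Variables (R : realType) (m : nat) (eps : 'I_m -> bool) (c : 'I_m -> R).

Definition sigma (i : 'I_m) : R :=
  \sum_(j < m | (j < i)%N) c j + (eps i)%:R * c i.

Definition phi (i : 'I_m) (t : R) : R := (-1) ^+ eps i * c i * t + sigma i.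

Definition phi_inv (i : 'I_m) (t : R) : R :=
  (t - sigma i) / ((-1) ^+ eps i * c i).

Lemma phiK (i : 'I_m) : c i != 0 -> cancel (phi i) (phi_inv i).
Proof.
by move=> ci t; rewrite /phi_inv /phi addrK mulrC mulKf// mulf_neq0// signr_eq0.
Qed.

End Parametrization.

(* [f] matters only on [0, 1]; [phi i @` `[0, 1]] is the interval I_i. *)
Definition self_affine_function (R : realType) (d m : nat)
    (eps : 'I_m -> bool) (c : 'I_m -> R)
    (S : 'I_m -> 'rV[R]_d.+1 -> 'rV[R]_d.+1) (f : R -> 'rV[R]_d.+1) : Prop :=
  {within `[0, 1], continuous f} /\
  forall i t, (phi eps c i @` `[0, 1]) t -> f t = S i (f (phi_inv eps c i t)).

Definition zero_derivative_set (R : realType) (d : nat)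
    (f : R -> 'rV[R]_d.+1) : set R :=
  [set t | [/\ 0 < t < 1, derivable f t 1 & f^`()%classic t = 0]].

Definition zero_derivative_compl (R : realType) (d : nat)
    (f : R -> 'rV[R]_d.+1) : set R :=
  `[0, 1] `\` zero_derivative_set f.

Section Hausdorff.
Variable R : realType.
Local Open Scope ereal_scope.

(* Only relevant for nonempty sets: [diam set0 = -oo]. *)
Definition diam (U : set R) : \bar R :=
  ereal_sup [set `|x.1 - x.2|%:E | x in U `*` U].

(* [diam U ^ s], with [0 ^ 0 = 1] for a point but [0] for the empty set. *)
Definition hausdorff_gauge (s : R) (U : set R) : \bar R :=
  if U == set0 then 0 else diam U `^ s.

Definition hausdorff_content (s delta : R) (E : set R) : \bar R :=
  ereal_inf [set \sum_(0 <= k <oo) hausdorff_gauge s (U k) |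
    U in [set U : nat -> set R |
           E `<=` \bigcup_k U k /\ forall k, diam (U k) <= delta%:E]].

Definition hausdorff_measure (s : R) (E : set R) : \bar R :=
  ereal_sup [set hausdorff_content s delta E | delta in [set x : R | (0 < x)%R]].

Definition hausdorff_dim (E : set R) : \bar R :=
  ereal_inf [set s%:E |
    s in [set s : R | (0 <= s)%R /\ hausdorff_measure s E = 0]].

End Hausdorff.

(* The sum runs over the nonconstant maps only. *)
Definition is_beta (R : realType) (m : nat) (lam c : 'I_m -> R)
    (beta : R -> R) : Prop :=
  forall q, \sum_(i < m | 0 < lam i) lam i `^ q * c i `^ beta q = 1.

Definition beta_star (R : realType) (beta : R -> R) (alpha : R) : \bar R :=
  ereal_inf [set (alpha * q + beta q)%:E | q in [set: R]].

(* Main.v *)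
Require Import Defs.
From HB Require Import structures.
From mathcomp Require Import all_boot all_order all_algebra.
From mathcomp Require Import all_classical all_reals all_analysis.
From mathcomp Require Import ring lra.
Set Implicit Arguments.
Unset Strict Implicit.
Unset Printing Implicit Defensive.
Import Order.TTheory GRing.Theory Num.Theory.
Import numFieldNormedType.Exports.

Local Open Scope classical_set_scope.
Local Open Scope ring_scope.

(* Write [x_i = lam_i / c_i], let I+ be the set of indices with [lam_i > 0], and
   let [lam_u], [c_u] be the products of the ratios along a word [u].  The
   pressure [G q s = sum_(i in I+) x_i ^ q * c_i ^ s] is decreasing in [s] and
   equals 1 at [s = q + beta q], so [beta_star beta 1] is the supremum of the [s]
   with [G q s >= 1] for all [q].

   Upper bounds.  If [f' t = 0] then [lam_u <= c_u] for all small cells containing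
   [t].  If [f' t <> 0], choose [h] with [|f (t + h) - f t| >= e |h|]; every point
   between [t] and [t + h] lies in a cell of length comparable to, but larger than,
   [|h|], and such a cell contains [t] or [t + h]; by the intermediate value theorem
   one of these cells has [lam_u >= e' c_u], and it lies within [c_u] of [t].  No
   separate discussion of the endpoints of cells is needed.  The words of length [n]
   with [lam_u <= c_u] (resp. [lam_u >= r ^ n c_u], [r < 1] close to 1) have
   [sum c_u ^ s] at most [G q s ^ n] for [q <= 0] (resp. [(r ^ (- q) G q s) ^ n] for
   [q >= 0]).

   Lower bounds.  If [G q s > 1] for all [q] of the relevant sign, Cramer's
   exponential tilting yields, for large [N], words [u] of length [N] with [x_u] as
   large (or small) as desired and [sum c_u ^ s] as large as desired.  Appending a
   word [v] whose cell avoids 0 and 1 makes the cells of these words separated, so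
   they generate a self-similar set of dimension at least [s], on which [lam_u / c_u]
   stays at least 1 (or on which [f' = 0], since the points stay away from the ends
   of the cells). *)

(** * Words of fixed length and sums of products over them *)

Section Words.
Variable T : eqType.

Fixpoint words (s : seq T) (n : nat) : seq (seq T) :=
  if n is n'.+1 then [seq i :: u | i <- s, u <- words s n'] else [:: [::]].

Lemma mem_words s n u : (u \in words s n) = (size u == n) && all (mem s) u.
Proof.
elim: n u => [|n IH] [|i u] //=.
- by apply/negbTE/allpairsPdep => -[? [? []]].
- apply/allpairsPdep/idP => [[j [v [js vs [-> ->]]]]|].
    by move: vs; rewrite IH eqSS /= => /andP[-> ->]; rewrite js.
  rewrite eqSS => /andP[su /andP[si au]].
  by exists i, u; split => //; rewrite IH su.
Qed.

Lemma words_uniq s n : uniq s -> uniq (words s n).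
Proof.
move=> us; elim: n => [//|n IH] /=.
by apply: allpairs_uniq => // -[i u] [j v] _ _ /= [-> ->].
Qed.

(** Distributivity: expanding the power gives one term per word. Sums over words thereby become
    powers of the pressure. *)
Lemma sum_words (R : comPzRingType) (F : T -> R) (s : seq T) n :
  \sum_(u <- words s n) \prod_(i <- u) F i = (\sum_(i <- s) F i) ^+ n.
Proof.
elim: n => [|n IH] /=; first by rewrite big_seq1 big_nil expr0.
rewrite big_allpairs_dep exprS mulr_suml; apply: eq_bigr => i _.
by rewrite -IH mulr_sumr; apply: eq_bigr => u _; rewrite big_cons.
Qed.

End Words.

Lemma exprn_eventually_small (R : realType) (r e : R) : 0 <= r < 1 -> 0 < e ->
  exists N0, forall N, (N0 <= N)%N -> r ^+ N <= e.
Proof.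
move=> /andP[r0 r1] e0.
have /cvgrPdist_le /(_ e e0) [N0 _ H] : (fun n => r ^+ n) @ \oo --> (0 : R).
  by apply: cvg_expr; rewrite ger0_norm.
exists N0 => N /H /=; rewrite sub0r normrN ger0_norm ?exprn_ge0//.
Qed.

Lemma exprn_eventually_large (R : realType) (r K : R) : 1 < r ->
  exists N0, forall N, (N0 <= N)%N -> K <= r ^+ N.
Proof.
move=> r1; have r0 : 0 < r by apply: lt_trans r1.
have K0 : 0 < `|K| + 1 by rewrite ltr_wpDl.
have r1' : 0 <= r^-1 < 1 by rewrite invr_ge0 ltW//= invf_lt1.
have [|N0 H] := @exprn_eventually_small R r^-1 (`|K| + 1)^-1 r1'.
  by rewrite invr_gt0.
exists N0 => N /H; rewrite exprVn lef_pV2 ?posrE ?exprn_gt0//.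
by apply: le_trans; rewrite (le_trans (ler_norm K))// lerDl.
Qed.

(** * Cramer's exponential tilting for sums over words *)

Section Cramer.
Variables (R : realType) (T : eqType) (s : seq T) (a y : T -> R).
Hypothesis a_gt0 : forall i, 0 < a i.

(** [H] is the moment generating function of [y] under the weights [a]; [H'] is its derivative,
    written out termwise. *)
Let H q := \sum_(i <- s) a i * expR (q * y i).
Let H' q := \sum_(i <- s) a i * y i * expR (q * y i).

(** The convex function [H] lies above its tangent at [r], by [1 + z <= expR z] with
    [z = (q - r) * y i] in each term. *)
Lemma expsum_convex q r : H r - H q <= (r - q) * H' r.
Proof.
rewrite /H /H' mulr_sumr -sumrB; apply: ler_sum => i _.
have -> : q * y i = r * y i + (q - r) * y i by ring.
rewrite expRD; have := expR_ge1Dx ((q - r) * y i); have := expR_gt0 (r * y i).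
move: (expR _) => E; move: (expR _) => F E0 F1.
have : 0 <= a i * E * (F - (1 + (q - r) * y i)).
  by rewrite !mulr_ge0 ?subr_ge0// ltW// a_gt0.
by lra.
Qed.

Lemma expsum_slope_incr q r : (exists2 i, i \in s & 0 < y i) -> q < r ->
  H' q < H' r.
Proof.
move=> [j js yj] qr; rewrite -subr_gt0 /H' -sumrB (big_rem j)//=.
apply: ltr_pwDl.
  rewrite subr_gt0 ltr_pM2l ?mulr_gt0// ltr_expR ltr_pM2r//.
apply: sumr_ge0 => i _; rewrite -mulrA -mulrA -mulrBr -mulrBr.
apply: mulr_ge0; first exact: ltW.
have [y0|y0] := leP 0 (y i).
  by rewrite mulr_ge0// subr_ge0 ler_expR ler_wpM2r// ltW.
by rewrite mulr_le0 ?(ltW y0)// subr_le0 ler_expR ler_nM2r// ltW.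
Qed.

Lemma continuous_expsum (b : T -> R) :
  continuous (fun q : R => \sum_(i <- s) b i * expR (q * y i)).
Proof.
move=> q; rewrite /continuous_at.
elim: s => [|i s' IH].
  by rewrite big_nil; under eq_fun do rewrite big_nil; exact: cvg_cst.
rewrite big_cons; under eq_fun do rewrite big_cons.
apply: cvgD => //.
apply: cvgM; first exact: cvg_cst.
apply: (cvg_comp (fun q => q * y i) expR); last exact: continuous_expR.
by apply: cvgM; [exact: cvg_id|exact: cvg_cst].
Qed.

(* The tilting parameter [q] has positive slope but its tangent line to [ln H]
   still has a positive intercept at [0]; [q'] and [r] witness this without
   derivatives of [ln H]. *)
Lemma tilting_parameter : (exists2 i, i \in s & 0 < y i) ->
  (forall q, 0 <= q -> 1 < H q) ->
  exists q' q r, [/\ q' < q, q < r, 0 <= q, 0 < H' q' &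
                     q * H' r < H q * ln (H q)].
Proof.
move=> [j js yj] H1.
have Hc : continuous H by apply: continuous_expsum.
have H'c : continuous H' by apply: continuous_expsum.
have Hinc := expsum_slope_incr (ex_intro2 _ _ j js yj).
have HlnH q : 0 <= q -> 0 < H q * ln (H q).
  by move=> /H1 h; rewrite mulr_gt0 ?ln_gt0// (lt_trans _ h).
(* If the slope at 0 is positive, [q = 0] works at once: the last inequality has left side 0, and
   continuity of [H'] provides [q' < 0]. *)
have [H'0|H'0] := ltP 0 (H' 0).
  have /cvgrPdist_lt /(_ _ H'0) [e /= e0 h] := H'c 0.
  exists (- (e / 2)), 0, 1; split; rewrite ?ltr01//.
  - by rewrite oppr_lt0 divr_gt0.
  - have /= := h (- (e / 2)); rewrite opprK add0r.
    rewrite ger0_norm ?divr_ge0 ?ltW// => /(_ _); move=> /(_ ltac:(lra)).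
    by move=> /(le_lt_trans (ler_norm _)); lra.
  - by rewrite mul0r HlnH.
(* At [b] the term of [j] alone exceeds [H 0], so [H 0 < H b], and convexity gives [H' b > 0]. *)
pose b := H 0 / (a j * y j).
have b0 : 0 <= b.
  by rewrite divr_ge0 ?mulr_ge0 ?ltW// ?(lt_trans _ (H1 0 _)).
have H'b : 0 < H' b.
  have Hb : H 0 < H b.
    rewrite {2}/H (big_rem j)//=.
    have : 0 <= \sum_(i <- rem j s) a i * expR (b * y i).
      by apply: sumr_ge0 => i _; rewrite mulr_ge0 ?expR_ge0// ltW.
    have : a j * (1 + b * y j) <= a j * expR (b * y j).
      by rewrite ler_pM2l ?expR_ge1Dx.
    have : a j * (b * y j) = H 0 by rewrite /b; field; rewrite !gt_eqF.
    have := a_gt0 j; lra.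
  have b1 : 0 < b.
    by rewrite lt_neqAle b0 andbT; apply/eqP => b00; move: Hb; rewrite -b00 ltxx.
  have := expsum_convex 0 b; rewrite subr0 => h.
  by have := lt_le_trans (_ : 0 < H b - H 0) h; rewrite pmulr_rgt0//; apply; rewrite subr_gt0.
have [q1] : exists2 c, c \in `[0, b] & H' c = 0.
  apply: IVT => //; first exact: continuous_subspaceT.
  by rewrite ge_min H'0/= le_max (ltW H'b) orbT.
rewrite in_itv/= => /andP[q10 _] H'q1.
(* At the critical point [q1] the inequality holds with room [B]. Points slightly to the right have
   positive slope and, by continuity of [H'], use up less than [B]. *)
pose B := H q1 * ln (H q1).
have B0 : 0 < B by exact: HlnH.
have B1 : 0 < B / (q1 + 1) by rewrite divr_gt0// ltr_wpDl.
have /cvgrPdist_lt /(_ _ B1) [e /= e0 h] := H'c q1.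
pose t := Num.min (e / 4) (1 / 4).
have t0 : 0 < t by rewrite lt_min; apply/andP; split; lra.
have te : t <= e / 4 by rewrite ge_min lexx.
have t1 : t <= 1 / 4 by rewrite ge_min lexx orbT.
have H't : 0 < H' (q1 + t) by rewrite -H'q1 Hinc// ltrDl.
exists (q1 + t), (q1 + 2 * t), (q1 + 3 * t); split => //; try lra.
have Hq : H q1 <= H (q1 + 2 * t).
  have := expsum_convex (q1 + 2 * t) q1; rewrite H'q1 mulr0; lra.
have HB : B <= H (q1 + 2 * t) * ln (H (q1 + 2 * t)).
  have h1 := H1 _ q10.
  apply: ler_pM => //; [lra|rewrite ltW// ln_gt0//|].
  by rewrite ler_ln// posrE; lra.
apply: lt_le_trans HB.
have H3 : H' (q1 + 3 * t) < B / (q1 + 1).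
  have /= := h (q1 + 3 * t); rewrite H'q1 sub0r normrN.
  have -> : q1 - (q1 + 3 * t) = - (3 * t) by ring.
  rewrite normrN ger0_norm; last lra.
  by move=> /(_ ltac:(lra)); apply: le_lt_trans; exact: ler_norm.
have H30 : 0 < H' (q1 + 3 * t) by apply: lt_trans H't _; apply: Hinc; lra.
apply: (@le_lt_trans _ _ ((q1 + 1) * H' (q1 + 3 * t))).
  by rewrite ler_pM2r//; lra.
by rewrite mulrC -ltr_pdivlMr// ltr_wpDl.
Qed.

Lemma weighted_word_sum q N :
  \sum_(u <- words s N) (\prod_(i <- u) a i) * expR (q * \sum_(i <- u) y i) =
  H q ^+ N.
Proof.
rewrite -sum_words; apply: eq_bigr => u _.
rewrite mulr_sumr expR_sum -big_split//.
Qed.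

(* Truncated Chernoff bound: the words outside [d N <= Y_u <= e N] are dominated
   by the tilted sums at [q'] and [r]. *)
Lemma truncated_tilt q' q r d e N : q' <= q -> q <= r -> 0 <= q ->
  expR (- (q * e)) ^+ N * (H q ^+ N - (expR (d * (q - q')) * H q') ^+ N -
     (expR (- (e * (r - q))) * H r) ^+ N) <=
  \sum_(u <- words s N | d * N%:R <= \sum_(i <- u) y i) \prod_(i <- u) a i.
Proof.
move=> q'q qr q0.
have expn z : expR z ^+ N = expR (N%:R * z) by rewrite mulrC expRM_natr.
rewrite !exprMn !expn -!weighted_word_sum !mulr_sumr -!sumrB mulr_sumr.
rewrite [leRHS]big_mkcond/=; apply: ler_sum => u _.
set Y := \sum_(i <- u) y i; set A := \prod_(i <- u) a i.
have A0 : 0 < A by rewrite /A; elim: (u) => [|i v IH]; rewrite ?big_nil// big_cons mulr_gt0.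
have -> : expR (N%:R * - (q * e)) * (A * expR (q * Y) -
    expR (N%:R * (d * (q - q'))) * (A * expR (q' * Y)) -
    expR (N%:R * - (e * (r - q))) * (A * expR (r * Y))) =
  A * (expR (N%:R * - (q * e)) * (expR (q * Y) -
    expR (N%:R * (d * (q - q')) + q' * Y) -
    expR (N%:R * - (e * (r - q)) + r * Y))) by rewrite !expRD; ring.
case: ifPn => [dY|].
  rewrite -[leRHS]mulr1 ler_pM2l//.
  have [Ye|Ye] := leP Y (e * N%:R).
    (* Inside the window [Y <= e * N%:R], so the prefactor cancels the tilt [expR (q * Y)]. *)
    apply: (@le_trans _ _ (expR (N%:R * - (q * e)) * expR (q * Y))).
      rewrite ler_pM2l ?expR_gt0//.
      have := expR_ge0 (N%:R * (d * (q - q')) + q' * Y).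
      have := expR_ge0 (N%:R * - (e * (r - q)) + r * Y); lra.
    rewrite -expRD expR_le1.
    have -> : N%:R * - (q * e) + q * Y = - (q * (e * N%:R - Y)) by ring.
    by rewrite oppr_le0 mulr_ge0// subr_ge0.
  apply: (@le_trans _ _ 0) => //.
  rewrite pmulr_rle0 ?expR_gt0//.
  have : expR (q * Y) <= expR (N%:R * - (e * (r - q)) + r * Y).
    rewrite ler_expR -subr_ge0.
    have -> : N%:R * - (e * (r - q)) + r * Y - q * Y = (r - q) * (Y - e * N%:R) by ring.
    by rewrite mulr_ge0// subr_ge0// ltW.
  have := expR_ge0 (N%:R * (d * (q - q')) + q' * Y); lra.
rewrite -ltNge => Yd.
rewrite pmulr_rle0// pmulr_rle0 ?expR_gt0//.
have : expR (q * Y) <= expR (N%:R * (d * (q - q')) + q' * Y).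
  rewrite ler_expR -subr_ge0.
  have -> : N%:R * (d * (q - q')) + q' * Y - q * Y = (q - q') * (d * N%:R - Y) by ring.
  by rewrite mulr_ge0// subr_ge0// ltW.
have := expR_ge0 (N%:R * - (e * (r - q)) + r * Y); lra.
Qed.

(** In [truncated_tilt] both error terms are geometrically smaller than [H q ^+ N], while
    [(expR (- (q * e)) * H q) ^+ N] grows without bound because [q * e < ln (H q)]. *)
Lemma cramer_lower_bound : (exists2 i, i \in s & 0 < y i) ->
  (forall q, 0 <= q -> 1 < H q) ->
  exists2 d, 0 < d & forall K, exists N0, forall N, (N0 <= N)%N ->
    K <= \sum_(u <- words s N | d * N%:R <= \sum_(i <- u) y i) \prod_(i <- u) a i.
Proof.
move=> sy H1.
have [q' [q [r [q'q qr q0 H'q' Hq]]]] := tilting_parameter sy H1.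
have Hq1 := H1 _ q0.
have Hq0 : 0 < H q by lra.
have Hpos p : 0 < H p.
  case: sy => j js yj; rewrite /H (big_rem j)//= ltr_pwDl//.
    by rewrite mulr_gt0// expR_gt0.
  by apply: sumr_ge0 => i _; rewrite mulr_ge0 ?expR_ge0// ltW.
have Hq'q : H q' < H q.
  have := expsum_convex q q'.
  have : 0 < (q - q') * H' q' by rewrite mulr_gt0// subr_gt0.
  have -> : (q' - q) * H' q' = - ((q - q') * H' q') by ring.
  lra.
pose gap := ln (H q) - q * (H' r / H q).
have gap0 : 0 < gap.
  rewrite subr_gt0 mulrA ltr_pdivrMr// [ltRHS]mulrC //.
(* Above the slope [H' r / H q], which controls the upper tail, yet with [q * e] below [ln (H q)];
   the denominator [q + 1] allows [q = 0]. *)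
pose e := H' r / H q + gap / (q + 1).
have q1 : 0 < q + 1 by lra.
have e1 : q * e < ln (H q).
  have -> : q * e = ln (H q) - gap / (q + 1) by rewrite /e /gap; field; rewrite !gt_eqF.
  by rewrite ltrBlDr ltrDl divr_gt0.
have Hr : expR (- (e * (r - q))) * H r < H q.
  rewrite expRN mulrC ltr_pdivrMr ?expR_gt0//.
  apply: (@lt_le_trans _ _ (H q * (1 + e * (r - q)))); last first.
    by rewrite ler_pM2l// expR_ge1Dx.
  have h := expsum_convex q r.
  have : (r - q) * H' r < H q * (e * (r - q)).
    have -> : H q * (e * (r - q)) = (r - q) * H' r + (r - q) * (H q * (gap / (q + 1))).
      by rewrite /e; field; rewrite !gt_eqF.
    by rewrite ltrDl mulr_gt0 ?subr_gt0// mulr_gt0// divr_gt0.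
  lra.
(* Makes [expR (d * (q - q')) * H q'] the geometric mean of [H q'] and [H q]. *)
pose d := ln (H q / H q') / (2 * (q - q')).
have d0 : 0 < d.
  rewrite divr_gt0 ?ln_gt0//; first by rewrite ltr_pdivlMr ?mul1r.
  by rewrite mulr_gt0// subr_gt0.
have Hd : expR (d * (q - q')) * H q' < H q.
  rewrite -ltr_pdivlMr// -[ltRHS]lnK ?posrE ?divr_gt0// ltr_expR.
  have -> : d * (q - q') = ln (H q / H q') / 2.
    by rewrite /d; field; rewrite subr_eq0 gt_eqF.
  have : 0 < ln (H q / H q') by rewrite ln_gt0// ltr_pdivlMr ?mul1r.
  lra.
exists d => // K.
(* Each error term takes at most a quarter of [H q ^+ N]; half of it remains, whence the factor 2
   before the absolute value of [K]. *)
have [N1 h1] : exists N0, forall N, (N0 <= N)%N -> (expR (d * (q - q')) * H q' / H q) ^+ N <= 1 / 4.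
  apply: exprn_eventually_small; last lra.
  by rewrite divr_ge0 ?mulr_ge0 ?expR_ge0 ?ltW//= ltr_pdivrMr ?mul1r.
have [N2 h2] : exists N0, forall N, (N0 <= N)%N -> (expR (- (e * (r - q))) * H r / H q) ^+ N <= 1 / 4.
  apply: exprn_eventually_small; last lra.
  by rewrite divr_ge0 ?mulr_ge0 ?expR_ge0 ?ltW//= ltr_pdivrMr ?mul1r.
have [N3 h3] : exists N0, forall N, (N0 <= N)%N -> 2 * `|K| <= (expR (- (q * e)) * H q) ^+ N.
  apply: exprn_eventually_large.
  by rewrite expRN mulrC ltr_pdivlMr ?expR_gt0// mul1r -[ltRHS]lnK// ltr_expR.
exists (maxn N1 (maxn N2 N3)) => N; rewrite !geq_max => /and3P[/h1 {}h1 /h2 {}h2 /h3 {}h3].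
apply: le_trans (truncated_tilt d e N (ltW q'q) (ltW qr) q0).
move: h1 h2; rewrite !expr_div_n !ler_pdivrMr ?exprn_gt0//.
move: h3; rewrite exprMn.
have : 0 < expR (- (q * e)) ^+ N by rewrite exprn_gt0// expR_gt0.
have := ler_norm K.
move: (expR (- (q * e)) ^+ N) (H q ^+ N) ((expR (d * (q - q')) * H q') ^+ N)
  ((expR (- (e * (r - q))) * H r) ^+ N) => E h x1 x2 Kn E0 h3 h1 h2.
have : 0 <= E * (h / 2 - x1 - x2) by apply: mulr_ge0; lra.
lra.
Qed.

End Cramer.

(** * Lower and upper bounds for Hausdorff dimension *)

Section HausdorffBounds.
Variable R : realType.
Implicit Types (E U : set R) (s : R).

Lemma le_diam U x y : U x -> U y -> (`|x - y|%:E <= diam U)%E.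
Proof. by move=> Ux Uy; apply: ereal_sup_ubound; exists (x, y). Qed.

Lemma diam_le U (l : R) : (forall x y, U x -> U y -> `|x - y| <= l) ->
  (diam U <= l%:E)%E.
Proof.
by move=> h; apply: ge_ereal_sup => _ [[x y] [Ux Uy] <-]; rewrite lee_fin h.
Qed.

Lemma diam_ge0 U : U !=set0 -> (0 <= diam U)%E.
Proof. by move=> [x Ux]; apply: le_trans (le_diam Ux Ux); rewrite lee_fin. Qed.

Lemma hausdorff_gauge_ge0 s U : (0 <= hausdorff_gauge s U)%E.
Proof. by rewrite /hausdorff_gauge; case: ifP => // _; exact: poweR_ge0. Qed.

Lemma hausdorff_gauge_le s U (l : R) : 0 <= s -> 0 <= l ->
  (forall x y, U x -> U y -> `|x - y| <= l) ->
  (hausdorff_gauge s U <= (l `^ s)%:E)%E.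
Proof.
move=> s0 l0 Ul; rewrite /hausdorff_gauge; case: ifPn => [_|/set0P U0].
  by rewrite lee_fin powR_ge0.
rewrite -poweR_EFin; apply: gt0_ler_poweR => //; last exact: diam_le.
  by rewrite in_itv/= diam_ge0// leey.
by rewrite in_itv/= lee_fin l0 leey.
Qed.

(** A number in [(0, 1]] has larger powers at smaller exponents. Diameter 0 is treated apart: its
    power is 0 for [s > 0], but 1 if [s' = 0]. *)
Lemma hausdorff_gauge_ge s s' U : 0 < s -> 0 <= s' <= s -> U !=set0 ->
  (diam U <= 1)%E -> exists2 l : R, 0 <= l &
  (forall x y, U x -> U y -> `|x - y| <= l) /\
  ((l `^ s)%:E <= hausdorff_gauge s' U)%E.
Proof.
move=> s0 /andP[s'0 s's] U0 U1.
have d0 := diam_ge0 U0.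
have dfin : diam U \is a fin_num.
  by rewrite ge0_fin_numE// (le_lt_trans U1)// ltry.
move: U1 (d0); rewrite -(fineK dfin) !lee_fin => l1 l0.
exists (fine (diam U)) => //; split.
  by move=> x y Ux Uy; rewrite -lee_fin fineK//; exact: le_diam.
rewrite /hausdorff_gauge; case: ifPn => [/eqP UU|_].
  by move: U0; rewrite UU => -[].
rewrite -{2}(fineK dfin) poweR_EFin lee_fin.
have [->|ln0] := eqVneq (fine (diam U)) 0.
  by rewrite powR0 ?gt_eqF// powR_ge0.
by apply: ger_powR => //; rewrite l1 lt_neqAle eq_sym ln0 l0.
Qed.

Lemma hausdorff_dim_ge0 E : (0 <= hausdorff_dim E)%E.
Proof. by apply: le_ereal_inf_tmp => _ [s [s0 _] <-]; rewrite lee_fin. Qed.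

Lemma hausdorff_dim_le s E : 0 <= s -> hausdorff_measure s E = 0%E ->
  (hausdorff_dim E <= s%:E)%E.
Proof. by move=> s0 h; apply: ereal_inf_lbound; exists s. Qed.

(** The inverse of [g] is Hoelder of exponent [s], so a cover of [E] by the [U k] pulls back to a
    cover of [[0, 1]] by intervals of length comparable to the gauges. Their total length is at
    least 1, which keeps the content above [(2 * C)^-1]. *)
Lemma mass_distribution (g : R -> R) (C s : R) E : 0 < s -> 0 < C ->
  (forall v : R, 0 <= v <= 1 -> E (g v)) ->
  (forall v w : R, 0 <= v <= 1 -> 0 <= w <= 1 -> `|v - w| <= C * `|g v - g w| `^ s) ->
  (s%:E <= hausdorff_dim E)%E.
Proof.
move=> s0 C0 Eg gC; apply: le_ereal_inf_tmp => _ [s' [s'0 Es'] <-].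
rewrite lee_fin leNgt; apply/negP => s's.
suff : ((2 * C)^-1%:E <= hausdorff_content s' 1 E)%E.
  apply/negP; rewrite -ltNge; apply: (@le_lt_trans _ _ 0%E).
    by rewrite -Es'; apply: ereal_sup_ubound; exists 1 => //=.
  by rewrite lte_fin invr_gt0 mulr_gt0.
apply: le_ereal_inf_tmp => _ [U [EU U1] <-].
have key k : exists V : set R, [/\ measurable V,
    (lebesgue_measure V <= (2 * C)%:E * hausdorff_gauge s' (U k))%E &
    forall v : R, 0 <= v <= 1 -> U k (g v) -> V v].
  have [[v0 [v01 Uv0]]|nU] := pselect (exists v : R, 0 <= v <= 1 /\ U k (g v)); last first.
    exists set0; split => //.
      by rewrite measure0 mule_ge0 ?hausdorff_gauge_ge0// lee_fin ltW ?mulr_gt0.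
    by move=> v v01 Uv; apply: nU; exists v.
  have Uk0 : U k !=set0 by exists (g v0).
  have s'01 : 0 <= s' <= s by rewrite s'0 ltW.
  have [l l0 [Ul hl]] := hausdorff_gauge_ge s0 s'01 Uk0 (U1 k).
  (* The pullback of [U k] may fail to be measurable; it lies in an interval centred at one of its
     points. *)
  exists `[v0 - C * l `^ s, v0 + C * l `^ s]%classic; split => //.
    apply: (@le_trans _ _ ((2 * C) * l `^ s)%:E).
      rewrite lebesgue_measure_itv/=; case: ifP => _; last first.
        by rewrite lee_fin !mulr_ge0// ?powR_ge0// ltW.
      by rewrite -EFinB lee_fin; lra.
    by rewrite EFinM lee_pmul2l// lte_fin mulr_gt0.
  move=> v v01' Uv /=.
  have h : `|v - v0| <= C * l `^ s.
    apply: le_trans (gC _ _ v01' v01) _; rewrite ler_pM2l//.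
    apply: ge0_ler_powR; rewrite ?nnegrE//; first exact: ltW.
    exact: Ul.
  by rewrite in_itv/= -ler_distlC distrC.
pose V k := sval (cid (key k)).
have [mV lV gV] : [/\ forall k, measurable (V k),
    forall k, (lebesgue_measure (V k) <= (2 * C)%:E * hausdorff_gauge s' (U k))%E &
    forall k (v : R), 0 <= v <= 1 -> U k (g v) -> V k v].
  by split => k; rewrite /V; case: (cid _) => W [].
have sub : `[0, 1] `<=` \bigcup_k V k.
  move=> v; rewrite /= in_itv/= => v01.
  have [k _ Uk] := EU _ (Eg _ v01); exists k => //; exact: gV.
have C20 : 0 < 2 * C by rewrite mulr_gt0.
rewrite -(@lee_pmul2l _ (2 * C)%:E)// -EFinM divff ?gt_eqF//.
rewrite -nneseriesZl; last by move=> *; exact: hausdorff_gauge_ge0.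
apply: (@le_trans _ _ (\sum_(0 <= k <oo) lebesgue_measure (V k))%E); last first.
  by apply: lee_nneseries => // k _; exact: lV.
have := @measure_sigma_subadditive _ _ _ (@lebesgue_measure R) `[0, 1]%classic V mV.
have m01 : measurable (`[0, 1]%classic : set R) by [].
move=> /(_ m01 sub); apply: le_trans.
have -> : (1 = lebesgue_measure (`[0%R, 1%R]%classic : set R))%E.
  by rewrite lebesgue_measure_itv/= lte_fin ltr01 oppr0 adde0.
exact: lexx.
Qed.

Lemma hausdorff_null (T : countType) (J : T -> set R) (l : T -> R) s E :
  0 < s -> (forall t, 0 <= l t) ->
  (forall t x y, J t x -> J t y -> `|x - y| <= l t) ->
  (forall d e : R, 0 < d -> 0 < e -> exists A : pred T,
     [/\ forall t, A t -> l t <= d,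
         forall x, E x -> exists2 t, A t & J t x &
         forall r : seq T, uniq r -> \sum_(t <- r | A t) l t `^ s <= e]) ->
  hausdorff_measure s E = 0%E.
Proof.
move=> s0 l0 Jl H; apply/eqP; rewrite eq_le; apply/andP; split; last first.
  apply: (@le_trans _ _ (hausdorff_content s 1 E)); last first.
    by apply: ereal_sup_ubound; exists 1 => //=.
  by apply: le_ereal_inf_tmp => _ [U _ <-]; apply: nneseries_ge0 => *; exact: hausdorff_gauge_ge0.
apply: ge_ereal_sup => _ [d /= d0 <-]; apply/lee_addgt0Pr => e e0; rewrite add0e.
have [A [Ad EA Ae]] := H d e d0 e0.
(* The family is enumerated by its codes; the remaining codes get the empty set, whose gauge is
   0. *)
pose U k := if @pickle_inv T k is Some t then if A t then J t else set0 else set0.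
apply: (@le_trans _ _ (\sum_(0 <= k <oo) hausdorff_gauge s (U k))%E).
  apply: ereal_inf_lbound; exists U => //; split.
    by move=> x /EA[t At Jx]; exists (pickle t) => //; rewrite /U pickleK_inv At.
  move=> k; rewrite /U; case: pickle_inv => [t|]; last by rewrite diam_le.
  case: ifP => [At|_]; last by rewrite diam_le.
  by apply: diam_le => x y Jx Jy; apply: le_trans (Ad _ At); exact: Jl.
apply: lime_le.
  by apply: is_cvg_nneseries => *; exact: hausdorff_gauge_ge0.
apply: nearW => n.
apply: (@le_trans _ _ (\sum_(0 <= k < n)
   (oapp (fun t => if A t then l t `^ s else 0) 0 (@pickle_inv T k))%:E)%E).
  apply: lee_sum => k _; rewrite /U.
  have g0 : (hausdorff_gauge s set0 <= 0 :> \bar R)%E by rewrite /hausdorff_gauge eqxx.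
  case: pickle_inv => [t|//=] /=; case: ifP => //= At.
  by apply: hausdorff_gauge_le => //; [exact: ltW|exact: Jl].
rewrite sumEFin lee_fin -big_pmap -big_mkcond; apply: Ae.
apply: (pmap_uniq (@pickle_invK T)); exact: iota_uniq.
Qed.

End HausdorffBounds.

(** * Coding maps of contractive systems on the interval *)

Section Contractions.
Variables (R : realType) (T : Type) (psi : T -> R -> R) (a : T -> R).
Hypothesis psi01 : forall i (x : R), 0 <= x <= 1 -> 0 <= psi i x <= 1.
Hypothesis psi_dist : forall i x y, `|psi i x - psi i y| = a i * `|x - y|.

Lemma foldr_map01 u x : 0 <= x <= 1 -> 0 <= foldr psi x u <= 1.
Proof. by move=> x01; elim: u => //= i u; exact: psi01. Qed.

Lemma foldr_map_dist u x y :
  `|foldr psi x u - foldr psi y u| = \prod_(i <- u) a i * `|x - y|.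
Proof.
elim: u => [|i u IH] /=; first by rewrite big_nil mul1r.
by rewrite psi_dist IH big_cons mulrA.
Qed.

Variable r : R.
Hypothesis r1 : r < 1.
Hypothesis ar : forall i, 0 <= a i <= r.

Lemma prod_le_exp u : 0 <= \prod_(i <- u) a i <= r ^+ size u.
Proof.
elim: u => [|i u /andP[IH1 IH2]]; first by rewrite big_nil ler01 lexx.
have /andP[a0 a1] := ar i.
by rewrite big_cons exprS mulr_ge0//= ler_pM.
Qed.

Lemma mkseqSl (w : nat -> T) n : mkseq w n.+1 = w 0%N :: mkseq (w \o S) n.
Proof. by rewrite /mkseq/= (iotaDl 1 0) -map_comp. Qed.

Definition code_point (w : nat -> T) : R :=
  lim ((fun n => foldr psi 0 (mkseq w n)) @ \oo).

(** All terms from [N] on lie in the image of [[0, 1]] under the first [N] maps, a set of diameter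
    at most [r ^+ N]. *)
Lemma cvg_code_point (w : nat -> T) :
  (fun n => foldr psi 0 (mkseq w n)) @ \oo --> code_point w.
Proof.
apply/cauchy_cvgP/cauchy_exP => e e0.
have r0 : 0 <= r by have /andP[h /(le_trans h)] := ar (w 0%N).
have e20 : 0 < e / 2 by rewrite divr_gt0.
have [N HN] : exists N0, forall N, (N0 <= N)%N -> r ^+ N <= e / 2.
  by apply: exprn_eventually_small; rewrite ?r0.
exists (foldr psi 0 (mkseq w N)); exists N => // n /= Nn.
rewrite -[n](subnKC Nn) /mkseq iotaD map_cat foldr_cat /= /ball/=.
rewrite foldr_map_dist.
have /andP[p0 p1] := prod_le_exp (map w (iota 0 N)).
have h0 : 0 <= (0 : R) <= 1 by rewrite lexx ler01.
have /andP[h1 h2] := foldr_map01 (map w (iota (0 + N) (n - N))) h0.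
apply: (@le_lt_trans _ _ (r ^+ N * 1)).
  rewrite ler_pM//; first by rewrite size_map size_iota in p1.
  by rewrite sub0r normrN ger0_norm.
by rewrite mulr1 (le_lt_trans (HN _ (leqnn _)))//; lra.
Qed.

Lemma code_point01 w : 0 <= code_point w <= 1.
Proof.
have h0 : 0 <= (0 : R) <= 1 by rewrite lexx ler01.
have cw := @cvg_code_point w.
by apply/andP; split; [apply: limr_ge|apply: limr_le];
  rewrite ?(cvgP _ cw)//; apply: nearW => n; have /andP[] := foldr_map01 (mkseq w n) h0.
Qed.

Lemma code_pointE w : code_point w = psi (w 0%N) (code_point (w \o S)).
Proof.
have c1 : (fun n => foldr psi 0 (mkseq w n.+1)) @ \oo --> code_point w.
  by have := @cvg_code_point w; rewrite -cvg_shiftS.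
have c2 : (fun n => foldr psi 0 (mkseq w n.+1)) @ \oo -->
    psi (w 0%N) (code_point (w \o S)).
  under eq_fun do rewrite mkseqSl/=.
  apply/cvgrPdist_le => e e0.
  have /cvgrPdist_le/(_ e e0) := @cvg_code_point (w \o S).
  apply: filterS => n h; rewrite psi_dist; apply: le_trans h.
  have /andP[a0 a1] := ar (w 0%N).
  by rewrite ler_piMl// (le_trans a1)// ltW.
by rewrite -(cvg_lim _ c1)// -(cvg_lim _ c2).
Qed.

Lemma code_point_prefix w n : exists2 y, 0 <= y <= 1 &
  code_point w = foldr psi y (mkseq w n).
Proof.
elim: n w => [|n IH] w; first by exists (code_point w) => //; exact: code_point01.
have [y y01 E] := IH (w \o S); exists y => //.
by rewrite mkseqSl /= -E -code_pointE.
Qed.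

End Contractions.

(** * The subdivision of the unit interval by the maps [phi] *)

Section Parametrization.
Variables (R : realType) (m : nat) (eps : 'I_m -> bool) (c : 'I_m -> R).
Hypothesis c0 : forall i, 0 < c i.
Hypothesis c1 : \sum_(i < m) c i = 1.
Local Notation phi := (phi eps c).

Let base (k : nat) : R := \sum_(j < m | (j < k)%N) c j.

(** Separates the left endpoint [base i] of the cell from its orientation, so that both orientations
    are treated alike. *)
Lemma phiE i x : phi i x = base i + c i * (if eps i then 1 - x else x).
Proof.
rewrite /Defs.phi /sigma -/(base i); case: (eps i) => /=.
  by rewrite expr1; ring.
by rewrite expr0; ring.
Qed.

Lemma baseS (i : 'I_m) : base i.+1 = base i + c i.
Proof.
rewrite /base (bigD1 i)/=; last exact: ltnSn.
rewrite addrC; congr (_ + _); apply: eq_bigl => j.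
by rewrite ltnS ltn_neqAle andbC.
Qed.

Lemma base_mono k l : (k <= l)%N -> base k <= base l.
Proof.
move=> kl; rewrite /base [leRHS](bigID (fun j : 'I_m => (j < k)%N))/=.
rewrite [in leRHS](eq_bigl (fun j : 'I_m => (j < k)%N)) ?lerDl; last first.
  by move=> j; rewrite andb_idl// => /leq_trans; exact.
apply: sumr_ge0 => j _; exact: ltW.
Qed.

Lemma base0 : base 0 = 0.
Proof. by rewrite /base big_pred0. Qed.

Lemma basem : base m = 1.
Proof. by rewrite /base -[RHS]c1; apply: eq_bigl => j; rewrite ltn_ord. Qed.

Lemma base_itv (i : 'I_m) : 0 <= base i /\ base i + c i <= 1.
Proof. by rewrite -baseS -base0 -basem !base_mono. Qed.

Lemma phi01 i x : 0 <= x <= 1 -> 0 <= phi i x <= 1.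
Proof.
move=> x01; rewrite phiE; have [b0 b1] := base_itv i; have ci := c0 i.
set y := if _ then _ else _.
have /andP[y0 y1] : 0 <= y <= 1 by rewrite /y; case: (eps i); lra.
have : 0 <= c i * y by rewrite mulr_ge0// ltW.
have : 0 <= c i * (1 - y) by rewrite mulr_ge0 ?subr_ge0// ltW.
lra.
Qed.

Lemma phi_dist i x y : `|phi i x - phi i y| = c i * `|x - y|.
Proof.
rewrite /Defs.phi opprD addrACA subrr addr0 -mulrBr !normrM normrX normrN1.
by rewrite expr1n mul1r gtr0_norm.
Qed.

(** Between the two points lie at least the last fraction [k] of cell [i] and the first fraction [k]
    of cell [j]. *)
Lemma phi_order (i j : 'I_m) (k x y : R) : (i < j)%N ->
  k <= x <= 1 - k -> k <= y <= 1 - k ->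
  phi i x + k * c i + k * c j <= phi j y.
Proof.
move=> ij xk yk; rewrite !phiE.
have bij : base i + c i <= base j by rewrite -baseS base_mono.
set x' := if _ then _ else _; set y' := if eps j then _ else _.
have [hx hy] : x' <= 1 - k /\ k <= y'.
  by split; rewrite /x' /y'; case: (eps _); lra.
have : 0 <= c i * (1 - k - x') by rewrite mulr_ge0 ?subr_ge0// ltW.
have : 0 <= c j * (y' - k) by rewrite mulr_ge0 ?subr_ge0// ltW.
lra.
Qed.

Lemma phi_cover x : 0 <= x <= 1 -> exists i y, 0 <= y <= 1 /\ x = phi i y.
Proof.
move=> /andP[x0 x1].
suff [i [h1 h2]] : exists i : 'I_m, base i <= x /\ x <= base i + c i.
  pose z := (x - base i) / c i.
  have z0 : 0 <= z by rewrite divr_ge0 ?subr_ge0// ltW.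
  have z1 : z <= 1 by rewrite ler_pdivrMr// mul1r lerBlDl.
  exists i, (if eps i then 1 - z else z); split; first by case: (eps i); lra.
  rewrite phiE; have -> : x = base i + c i * z by rewrite /z; field; rewrite gt_eqF.
  by case: (eps i) => //; congr (_ + _ * _); ring.
have m0 : (0 < m)%N.
  by rewrite lt0n; apply/eqP => m0; move: basem; rewrite m0 base0 => /esym/eqP; rewrite oner_eq0.
(* Lowering [k] finds the cell where [base] passes [x]; at [k = 0] the point is 0 and the first cell
   contains it. *)
suff H k : (k <= m)%N -> x <= base k -> exists i : 'I_m, base i <= x /\ x <= base i + c i.
  by apply: (H m) => //; rewrite basem.
elim: k => [_ xb|k IH km xb].
  exists (Ordinal m0); rewrite -baseS; rewrite base0 in xb *; split => //.
  by apply: (le_trans xb); rewrite -base0 base_mono.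
have [h|h] := leP x (base k); first by apply: IH => //; exact: ltnW.
by exists (Ordinal km); rewrite -baseS /=; split => //; exact: ltW.
Qed.

End Parametrization.

(** Selects the digit and remainder functions of an expansion; [b] and [c] are defaults outside
    [P]. *)
Lemma choice2 (A B C : Type) (b : B) (c : C) (P : A -> Prop) (Q : A -> B -> C -> Prop) :
  (forall x, P x -> exists y z, Q x y z) ->
  exists f g, forall x, P x -> Q x (f x) (g x).
Proof.
move=> H; have [h hP] : {h : A -> B * C & forall x, P x -> Q x (h x).1 (h x).2}.
  apply: (@choice A (B * C)%type (fun x p => P x -> Q x p.1 p.2)) => x.
  have [Px|nP] := pselect (P x); last by exists (b, c).
  by have [y [z q]] := H x Px; exists (y, z).
by exists (fst \o h), (snd \o h).
Qed.

(** * Moran's lower bound for separated self-similar sets *)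

Section Moran.
Variables (R : realType) (K : nat) (psi : 'I_K -> R -> R) (a : 'I_K -> R).
Hypothesis psi01 : forall i (x : R), 0 <= x <= 1 -> 0 <= psi i x <= 1.
Hypothesis psi_dist : forall i x y, `|psi i x - psi i y| = a i * `|x - y|.

(* The set coded by all sequences is parametrized by the sequences of digits of
   [0, 1] in the expansion with weights [p i = a i ^ s / Z]. *)
Lemma moran_lower_bound (r k s : R) (E : set R) : 0 < s -> 0 < k -> r < 1 ->
  (forall i, 0 < a i <= r) ->
  (forall i j x y, i != j -> 0 <= x <= 1 -> 0 <= y <= 1 ->
     k <= `|psi i x - psi j y|) ->
  1 <= \sum_(i < K) a i `^ s ->
  (forall (w : nat -> 'I_K) x,
     (forall n, exists2 y, 0 <= y <= 1 & x = foldr psi y (mkseq w n)) -> E x) ->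
  (s%:E <= hausdorff_dim E)%E.
Proof.
move=> s0 k0 r1 ar sep sum1 EP.
have ar' i : 0 <= a i <= r by have /andP[h ->] := ar i; rewrite ltW.
have a0 i : 0 < a i by have /andP[] := ar i.
pose Z := \sum_(i < K) a i `^ s.
have Z0 : 0 < Z by apply: lt_le_trans sum1.
pose p i := a i `^ s / Z.
have p0 i : 0 < p i by rewrite divr_gt0// powR_gt0.
have pa i : p i <= a i `^ s by rewrite ler_pdivrMr// ler_peMr// powR_ge0.
have psum : \sum_(i < K) p i = 1 by rewrite -mulr_suml divff// gt_eqF.
pose e0 (i : 'I_K) := false.
have [i0 [y0 [y001 _]]] := @phi_cover R K e0 p p0 psum 0 ltac:(by rewrite lexx ler01).
(* [D v] is the first digit of [v] in the subdivision with weights [p], and [T v] is the rescaled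
   remainder. *)
have [D [T DT]] := choice2 i0 y0 (@phi_cover R K e0 p p0 psum).
pose code v n := D (iter n T v).
have codeS v : code v \o S = code (T v) by apply/funext => n; rewrite /code/= -iterSr.
pose g v := code_point psi (code v).
have gE v : g v = psi (D v) (g (T v)).
  by rewrite /g (code_pointE psi01 psi_dist r1 ar') codeS.
have g01 v : 0 <= g v <= 1 by exact: (code_point01 psi01 psi_dist r1 ar' (code v)).
pose C := (k `^ s)^-1.
have ks0 : 0 < k `^ s by rewrite powR_gt0.
have C0 : 0 < C by rewrite invr_gt0.
have rs : 0 <= r `^ s < 1.
  rewrite powR_ge0/=; have -> : 1 = (1 : R) `^ s by rewrite powR1.
  have /andP[h1 h2] := ar' i0.
  by apply: gt0_ltr_powR; rewrite ?nnegrE// (le_trans h1 h2).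
(* Equal first digits scale the left side by [p i] and the last term by [a i] to the power [s],
   which is at least [p i]. At different digits the points are [k] apart, and [C] makes the last
   term at least 1. The first term vanishes as [n] grows. *)
have step n v w : 0 <= v <= 1 -> 0 <= w <= 1 ->
    `|v - w| <= (r `^ s) ^+ n + C * `|g v - g w| `^ s.
  elim: n v w => [|n IH] v w v01 w01.
    rewrite expr0; apply: (@le_trans _ _ 1).
      by rewrite ler_distl; apply/andP; split; lra.
    by rewrite lerDl mulr_ge0 ?powR_ge0// ltW.
  have [Tv01 vE] := DT _ v01; have [Tw01 wE] := DT _ w01.
  have [Dvw|Dvw] := eqVneq (D v) (D w); last first.
    apply: (@le_trans _ _ 1); first by rewrite ler_distl; apply/andP; split; lra.
    apply: (@le_trans _ _ (C * `|g v - g w| `^ s)); last first.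
      by rewrite lerDr exprn_ge0// powR_ge0.
    rewrite mulrC ler_pdivlMr// mul1r ge0_ler_powR ?nnegrE ?(ltW k0) ?(ltW s0)//.
    by rewrite (gE v) (gE w); apply: sep.
  rewrite {1}vE {1}wE -Dvw phi_dist//.
  have gvw : `|g v - g w| = a (D v) * `|g (T v) - g (T w)|.
    by rewrite gE (gE w) -Dvw psi_dist.
  rewrite gvw powRM// ?(ltW (a0 _))//.
  have pD : p (D v) <= r `^ s.
    apply: le_trans (pa _) _; have /andP[h1 h2] := ar' (D v).
    by apply: ge0_ler_powR; rewrite ?nnegrE// ?(ltW s0)// (le_trans h1 h2).
  apply: le_trans (_ : p (D v) * ((r `^ s) ^+ n + C * `|g (T v) - g (T w)| `^ s) <= _).
    by rewrite ler_pM2l//; exact: IH.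
  rewrite mulrDr exprS; apply: lerD.
    by rewrite ler_wpM2r// exprn_ge0// powR_ge0.
  rewrite mulrCA ler_pM2l//; apply: ler_wpM2r; [exact: powR_ge0|exact: pa].
apply: (@mass_distribution R g C s E s0 C0).
  move=> v v01; apply: (EP (code v)) => n.
  exact: (code_point_prefix psi01 psi_dist r1 ar').
move=> v w v01 w01; apply/ler_addgt0Pr => e e0'.
have [N h] := exprn_eventually_small rs e0'.
by apply: le_trans (step N v w v01 w01) _; rewrite addrC lerD2l; exact: h.
Qed.

End Moran.

(** * Comparison of the Euclidean and the sup norm *)

Section EuclideanNorm.
Variables (R : realType) (d : nat).
Implicit Type x : 'rV[R]_d.+1.

Lemma enorm_ge0 x : 0 <= enorm x. Proof. exact: sqrtr_ge0. Qed.

Lemma coord_le_enorm x j : `|x 0 j| <= enorm x.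
Proof.
rewrite /enorm -sqrtr_sqr ler_wsqrtr// (bigD1 j)//= lerDl.
by apply: sumr_ge0 => i _; exact: sqr_ge0.
Qed.

Lemma coord_le_norm x j : `|x 0 j| <= `|x|.
Proof.
rewrite [leRHS]/Num.norm/= mx_normrE.
exact: (le_bigmax _ (fun ij : 'I_1 * 'I_d.+1 => `|x ij.1 ij.2|) (0, j)).
Qed.

Lemma norm_le_enorm x : `|x| <= enorm x.
Proof.
rewrite [leLHS]/Num.norm/= mx_normrE; apply: bigmax_le; first exact: enorm_ge0.
by move=> [i j] _ /=; rewrite (ord1 i); exact: coord_le_enorm.
Qed.

Lemma enorm_le_norm x : enorm x <= d.+1%:R * `|x|.
Proof.
rewrite -[leRHS]ger0_norm ?mulr_ge0// -sqrtr_sqr ler_wsqrtr//.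
apply: (@le_trans _ _ (\sum_(j < d.+1) `|x| ^+ 2)).
  apply: ler_sum => j _.
  by rewrite -(real_normK (num_real (x 0 j))) lerXn2r ?nnegrE//; exact: coord_le_norm.
rewrite sumr_const card_ord exprMn -[leLHS]mulr_natl ler_wpM2r ?sqr_ge0//.
by rewrite expr2 ler_peMr// ler1n.
Qed.

Lemma enorm_eq0 x : enorm x = 0 -> x = 0.
Proof.
move=> x0; apply/eqP; rewrite -normr_eq0 eq_le normr_ge0 andbT -x0.
exact: norm_le_enorm.
Qed.

Lemma enormN x : enorm (- x) = enorm x.
Proof. by rewrite /enorm; congr Num.sqrt; apply: eq_bigr => j _; rewrite mxE sqrrN. Qed.

Lemma enorm_ptb : enorm (ptb R d.+1) = 1.
Proof.
rewrite /enorm big_ord_recl mxE/= expr1n big1 ?addr0 ?sqrtr1// => j _.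
by rewrite mxE/= expr0n.
Qed.

End EuclideanNorm.

(** * Vanishing derivative without difference quotients *)

Section ZeroDerivative.
Variables (R : realType) (d : nat) (f : R -> 'rV[R]_d.+1).

(** Clearing the denominator [h] and using a weak inequality makes [h = 0] harmless. *)
Lemma zero_derivative_setP t : zero_derivative_set f t <->
  0 < t < 1 /\ forall e : R, 0 < e -> exists2 n : R, 0 < n &
    forall h, `|h| < n -> `|f (h + t) - f t| <= e * `|h|.
Proof.
have key : ((fun h : R => h^-1 *: (f (h + t) - f t)) @ 0^' --> (0 : 'rV[R]_d.+1)) <->
   forall e : R, 0 < e -> exists2 n : R, 0 < n &
    forall h, `|h| < n -> `|f (h + t) - f t| <= e * `|h|.
  split => [/cvgrPdist_le H e e0|H].
    have [n /= n0 hn] := H e e0; exists n => // h hln.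
    have [->|h0] := eqVneq h 0.
      by rewrite add0r subrr !normr0 mulr0.
    have := hn h; rewrite /= !sub0r !normrN => /(_ hln h0).
    by rewrite normrZ normfV ler_pdivrMl ?normr_gt0// mulrC.
  apply/cvgrPdist_le => e e0; have [n n0 hn] := H e e0.
  exists n => //= h; rewrite /= !sub0r !normrN => hln h0.
  by rewrite normrZ normfV ler_pdivrMl ?normr_gt0// mulrC; exact: hn.
have dE : (fun h : R => h^-1 *: ((f \o shift t) (h *: (1 : R^o)) - f t)) =
          (fun h : R => h^-1 *: (f (h + t) - f t)).
  by apply/funext => h /=; rewrite [h *: _]mulr1.
split.
  move=> [t01 dft f't]; split=> //; apply/key.
  move: dft; rewrite /derivable dE => /cvg_ex[l cl].
  suff <- : l = 0 by [].
  by rewrite -f't /derive1; apply/esym/cvg_lim.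
move=> [t01 /key H]; split => //.
  by rewrite /derivable dE; apply: cvgP H.
by rewrite /derive1; apply/cvg_lim.
Qed.

End ZeroDerivative.

(** Starting the minimum at 1 covers an empty [T] and gives [k <= 1]. *)
Lemma exists_min_gt0 (R : realType) (T : finType) (F : T -> R) :
  (forall i, 0 < F i) -> exists2 k, 0 < k <= 1 & forall i, k <= F i.
Proof.
move=> F0; exists (\big[Num.min/1]_i F i); last by move=> i; exact: bigmin_le.
by rewrite bigmin_le_id andbT; apply: lt_bigmin.
Qed.

(** * Cells addressed by words *)

Section Cells.
Variables (R : realType) (m : nat) (eps : 'I_m -> bool) (c : 'I_m -> R).
Hypothesis c_gt0 : forall i, 0 < c i.
Hypothesis c_sum1 : \sum_(i < m) c i = 1.

(** Parametrizes by [[0, 1]] the cell with address [u]. The first letter is the outermost map, so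
    appending letters refines the cell. *)
Definition cell (u : seq 'I_m) (x : R) : R := foldr (phi eps c) x u.

Lemma cell01 u x : 0 <= x <= 1 -> 0 <= cell u x <= 1.
Proof. exact: (foldr_map01 (phi01 eps c_gt0 c_sum1)). Qed.

Lemma cell_cat u v x : cell (u ++ v) x = cell u (cell v x).
Proof. exact: foldr_cat. Qed.

Lemma cell_dist u x y : `|cell u x - cell u y| = \prod_(i <- u) c i * `|x - y|.
Proof. exact: (foldr_map_dist (phi_dist eps c_gt0)). Qed.

(** The orientation, a product of signs along [u], is kept only as the sign of [s]. *)
Lemma cell_affine u : exists2 s : R, `|s| = \prod_(i <- u) c i &
  forall x h, cell u (x + h) = cell u x + s * h.
Proof.
elim: u => [|i u [s s1 H]].
  by exists 1; [rewrite normr1 big_nil|move=> x h; rewrite mul1r].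
exists ((-1) ^+ eps i * c i * s).
  by rewrite big_cons !normrM normrX normrN1 expr1n mul1r s1 gtr0_norm.
by move=> x h; rewrite /= H /phi; ring.
Qed.

Lemma prod_gt0 u : 0 < \prod_(i <- u) c i.
Proof. by elim: u => [|i u IH]; rewrite ?big_nil// big_cons mulr_gt0. Qed.

Lemma cell_shift u x h : exists2 k : R, `|k| = `|h| / \prod_(i <- u) c i &
  cell u x + h = cell u (x + k).
Proof.
have [s s1 H] := cell_affine u; have p0 := prod_gt0 u.
have s0 : s != 0 by rewrite -normr_gt0 s1.
exists (h / s); first by rewrite normrM normfV s1.
by rewrite H mulrC divfK.
Qed.

Lemma cell_cover n x : 0 <= x <= 1 -> exists2 u, size u = n &
  exists2 y, 0 <= y <= 1 & x = cell u y.
Proof.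
elim: n x => [|n IH] x x01; first by exists [::] => //; exists x.
have [i [y [y01 ->]]] := phi_cover eps c_gt0 c_sum1 x01.
have [u su [z z01 ->]] := IH y y01.
by exists (i :: u); [rewrite /= su|exists z].
Qed.

Hypothesis m2 : (2 <= m)%N.

Lemma c_lt1 i : c i < 1.
Proof.
have [j ji] : exists j : 'I_m, j != i.
  have m0 : (0 < m)%N by exact: ltn_trans m2.
  have [->|ni] := eqVneq i (Ordinal m0).
    by exists (Ordinal m2); rewrite -val_eqE.
  by exists (Ordinal m0); rewrite eq_sym.
rewrite -c_sum1 (bigD1 i)//= ltrDl (bigD1 j)//= ltr_wpDr//.
by apply: sumr_ge0 => k _; exact: ltW.
Qed.

Lemma c_max : exists2 r, 0 <= r < 1 & forall i, c i <= r.
Proof.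
have H i : 0 < 1 - c i by rewrite subr_gt0 c_lt1.
have [k /andP[k0 k1] kP] := exists_min_gt0 H.
by exists (1 - k) => [|i]; [lra|have := kP i; lra].
Qed.

Lemma prod_lower (k : R) u : 0 < k -> (forall i, k <= c i) ->
  k ^+ size u <= \prod_(i <- u) c i.
Proof.
move=> k0 kc; elim: u => [|i u IH]; first by rewrite big_nil.
by rewrite big_cons exprS ler_pM// ?exprn_ge0// ltW.
Qed.

(** Stopping time: while [r < k], descend to the subcell containing [x] and divide [r] by its
    length. A number [n] with [k * q ^+ n <= r] bounds the number of descents. *)
Lemma stopping_cell (k r x : R) : 0 < k -> (forall i, k <= c i) ->
  0 < r < 1 -> 0 <= x <= 1 ->
  exists u y, [/\ 0 <= y <= 1, x = cell u y, r < \prod_(i <- u) c i &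
                  k * \prod_(i <- u) c i <= r].
Proof.
move=> k0 kc /andP[r0 r1] x01.
have [q /andP[q0 q1] cq] := c_max.
have [n hn] : exists n, k * q ^+ n <= r.
  have q01 : 0 <= q < 1 by rewrite q0.
  have rk : 0 < r / k by rewrite divr_gt0.
  have [N /(_ N (leqnn _))] := exprn_eventually_small q01 rk.
  by rewrite ler_pdivlMr// mulrC => h; exists N.
elim: n r x r0 r1 x01 hn => [|n IH] r x r0 r1 x01 hn.
  by exists [::], x; split; rewrite ?big_nil.
have [kr|rk] := leP k r.
  by exists [::], x; split; rewrite ?big_nil// mulr1.
have [i [y [y01 xE]]] := phi_cover eps c_gt0 c_sum1 x01.
have ci := c_gt0 i.
have [|||u [z [z01 yE rp pr]]] := IH (r / c i) y _ _ y01 _.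
- by rewrite divr_gt0.
- by rewrite ltr_pdivrMr// mul1r (lt_le_trans rk).
- rewrite ler_pdivlMr//; apply: le_trans hn.
  by rewrite exprSr mulrA ler_wpM2l ?cq// mulr_ge0 ?exprn_ge0// ltW.
exists (i :: u), z; split => //; first by rewrite xE yE.
  by rewrite big_cons mulrC -ltr_pdivrMr.
by rewrite big_cons mulrCA mulrC -ler_pdivlMr.
Qed.

End Cells.

(** * Local behaviour of the self-affine function on cells *)

Section SelfAffine.
Variables (R : realType) (d m : nat) (eps : 'I_m -> bool)
  (S : 'I_m -> 'rV[R]_d.+1 -> 'rV[R]_d.+1) (lam c : 'I_m -> R)
  (f : R -> 'rV[R]_d.+1).
Hypothesis m2 : (2 <= m)%N.
Hypothesis hlam : forall i, 0 <= lam i < 1.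
Hypothesis hS : forall i, similitude (S i) (lam i).
Hypothesis hSfirst : forall i : 'I_m, (i : nat) = 0%N ->
  S i (entry R d.+1 (eps i)) = pta R d.+1.
Hypothesis hSlast : forall i : 'I_m, (i : nat).+1 = m ->
  S i (exit R d.+1 (eps i)) = ptb R d.+1.
Hypothesis c_gt0 : forall i, 0 < c i.
Hypothesis c_sum1 : \sum_(i < m) c i = 1.
Hypothesis hf : self_affine_function eps c S f.

Local Notation cell := (cell eps c).
Local Notation lamw u := (\prod_(i <- u) lam i).
Local Notation cw u := (\prod_(i <- u) c i).

Lemma f_phi i x : 0 <= x <= 1 -> f (phi eps c i x) = S i (f x).
Proof.
move=> x01; rewrite (hf.2 i); last by exists x => //=; rewrite in_itv.
by rewrite phiK// gt_eqF.
Qed.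

Lemma f_cell_enorm u x y : 0 <= x <= 1 -> 0 <= y <= 1 ->
  enorm (f (cell u x) - f (cell u y)) = lamw u * enorm (f x - f y).
Proof.
move=> x01 y01; elim: u => [|i u IH]; first by rewrite big_nil mul1r.
have h z : 0 <= z <= 1 -> 0 <= cell u z <= 1 by exact: cell01.
by rewrite [cell _ _]/(phi _ _ _ _) [cell (_ :: _) _]/(phi _ _ _ _) !f_phi ?h// hS IH big_cons mulrA.
Qed.

Let phi_start i : phi eps c i (eps i)%:R = \sum_(j < m | (j < i)%N) c j.
Proof. by rewrite phiE; case: (eps i); rewrite ?subrr mulr0 addr0. Qed.

Let phi_end i : phi eps c i (~~ eps i)%:R = \sum_(j < m | (j < i.+1)%N) c j.
Proof. by rewrite phiE baseS; case: (eps i); rewrite /= ?subr0 mulr1. Qed.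

Let bool01 (b : bool) : 0 <= (b%:R : R) <= 1.
Proof. by case: b; rewrite lexx ler01. Qed.

(** Each of the two distances to be shown zero is a ratio below 1 times itself or the other one,
    depending on the orientation of the first and last maps; in all four cases both vanish. *)
Lemma f_endpoints : f 0 = pta R d.+1 /\ f 1 = ptb R d.+1.
Proof.
have m0 : (0 < m)%N by exact: ltn_trans m2.
pose i0 := Ordinal m0.
have lm : (m.-1 < m)%N by rewrite prednK.
pose l := Ordinal lm.
have H0 : enorm (f 0 - pta R d.+1) =
    lam i0 * enorm (f (eps i0)%:R - entry R d.+1 (eps i0)).
  by rewrite -(hSfirst (i := i0))// -hS -f_phi// phi_start base0.
have H1 : enorm (f 1 - ptb R d.+1) =
    lam l * enorm (f (~~ eps l)%:R - exit R d.+1 (eps l)).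
  rewrite -(hSlast (i := l)) ?prednK// -hS -f_phi// phi_end.
  by rewrite /= prednK// basem.
have eE e : entry R d.+1 e = if e then ptb R d.+1 else pta R d.+1.
  by rewrite /entry /pta scaler0 add0r; case: e; rewrite ?scale1r ?scale0r.
have xE e : exit R d.+1 e = if e then pta R d.+1 else ptb R d.+1.
  by rewrite /exit /pta scaler0 add0r; case: e; rewrite /= ?subrr ?subr0 ?scale1r ?scale0r.
have a0 := enorm_ge0 (f 0 - pta R d.+1); have b0 := enorm_ge0 (f 1 - ptb R d.+1).
have /andP[p0 p1] := hlam i0; have /andP[q0 q1] := hlam l.
move: H0 H1; rewrite eE xE.
suff H : enorm (f 0 - pta R d.+1) = 0 /\ enorm (f 1 - ptb R d.+1) = 0 ->
    f 0 = pta R d.+1 /\ f 1 = ptb R d.+1.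
  move=> H0 H1; apply: H; move: H0 H1 a0 b0.
  move: p0 p1 q0 q1; set p := lam i0; set q := lam l.
  case: (eps i0) => /=; case: (eps l) => /=;
  set A := enorm _; set B := enorm _ => p0 p1 q0 q1 HA HB A0 B0.
  - have hA : A = p * q * A by rewrite -mulrA -HB.
    have pq : p * q < 1 by rewrite mulr_ilt1.
    have : (1 - p * q) * A = 0 by rewrite mulrBl mul1r -hA subrr.
    move/eqP; rewrite mulf_eq0 subr_eq0 gt_eqF//= => /eqP A00.
    by rewrite HB A00 mulr0.
  - have : (1 - q) * B = 0 by rewrite mulrBl mul1r -HB subrr.
    move/eqP; rewrite mulf_eq0 subr_eq0 gt_eqF//= => /eqP B00.
    by rewrite HA B00 mulr0.
  - have : (1 - p) * A = 0 by rewrite mulrBl mul1r -HA subrr.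
    move/eqP; rewrite mulf_eq0 subr_eq0 gt_eqF//= => /eqP A00.
    by rewrite HB A00 mulr0.
  - have : (1 - p) * A = 0 by rewrite mulrBl mul1r -HA subrr.
    have : (1 - q) * B = 0 by rewrite mulrBl mul1r -HB subrr.
    by move/eqP; rewrite mulf_eq0 subr_eq0 gt_eqF//= => /eqP ->
      /eqP; rewrite mulf_eq0 subr_eq0 gt_eqF//= => /eqP ->.
by move=> [/enorm_eq0/eqP + /enorm_eq0/eqP]; rewrite !subr_eq0 => /eqP -> /eqP ->.
Qed.

Lemma f_increment (b : bool) : enorm (f (~~ b)%:R - f b%:R) = 1.
Proof.
have [f0 f1] := f_endpoints; case: b; rewrite /= f0 f1 /pta.
  by rewrite sub0r enormN enorm_ptb.
by rewrite subr0 enorm_ptb.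
Qed.

(** The first coordinate of [f] rises from 0 to 1; telescoping over the cells, its rise over cell
    [i] is at most [lam i]. *)
Lemma sum_lam_ge1 : 1 <= \sum_(i < m) lam i.
Proof.
pose F k : R := f (\sum_(j < m | (j < k)%N) c j) 0 0.
have -> : 1 = \sum_(i < m) (F i.+1 - F i).
  rewrite -(big_mkord xpredT (fun i => F i.+1 - F i)) telescope_sumr//.
  have [f0 f1] := f_endpoints.
  by rewrite /F basem// base0 f0 f1 /pta !mxE /= subr0.
apply: ler_sum => i _; rewrite /F -phi_end -phi_start.
apply: (@le_trans _ _ (enorm (f (phi eps c i (~~ eps i)%:R) - f (phi eps c i (eps i)%:R)))).
  apply: le_trans (coord_le_enorm _ 0); rewrite !mxE; exact: ler_norm.
by rewrite !f_phi// hS f_increment mulr1.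
Qed.

(** Otherwise the ratios, being dominated by the [c i] and not all equal to them, would sum to less
    than 1. *)
Lemma exists_lam_gt : ~ (forall i, lam i = c i) -> exists i, c i < lam i.
Proof.
move=> hne; apply: contrapT => hn; apply: hne => i; apply/eqP.
have le j : lam j <= c j.
  by rewrite leNgt; apply/negP => h; apply: hn; exists j.
rewrite eq_le le/= leNgt; apply/negP => lt.
have := sum_lam_ge1; rewrite leNgt => /negP; apply.
rewrite -c_sum1 (bigD1 i)//= [ltRHS](bigD1 i)//=.
by apply: ltr_leD => //; apply: ler_sum.
Qed.

Lemma f_bounded : exists2 M : R, 0 < M & forall x y, 0 <= x <= 1 -> 0 <= y <= 1 ->
  enorm (f x - f y) <= M.
Proof.
have /compact_bounded[M [_ hM]] := continuous_compact hf.1 (@segment_compact R 0 1).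
have {}hM x : 0 <= x <= 1 -> `|f x| <= `|M| + 1.
  move=> x01; apply: (hM (`|M| + 1)).
    by rewrite (le_lt_trans (ler_norm M))// ltrDl.
  by exists x => //=; rewrite in_itv.
have M0 : 0 < `|M| + 1 by rewrite ltr_wpDl.
exists (d.+1%:R * (2 * (`|M| + 1))); first by rewrite !mulr_gt0.
move=> x y /hM hx /hM hy; apply: le_trans (enorm_le_norm _) _.
rewrite ler_pM2l//; apply: le_trans (ler_normB _ _) _; lra.
Qed.

Lemma f_osc (M : R) u x y :
  (forall x y, 0 <= x <= 1 -> 0 <= y <= 1 -> enorm (f x - f y) <= M) ->
  0 <= x <= 1 -> 0 <= y <= 1 -> `|f (cell u x) - f (cell u y)| <= M * lamw u.
Proof.
move=> hM x01 y01; apply: le_trans (norm_le_enorm _) _.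
rewrite f_cell_enorm// mulrC ler_wpM2r//; last exact: hM.
by elim: (u) => [|i v IH]; rewrite ?big_nil// big_cons mulr_ge0//; have /andP[] := hlam i.
Qed.

(** In the coordinate of the cell, [a] and [b] lie at distances [p] and [q] on opposite sides of
    [z]. As [p + q < 1], they cannot both leave [[0, 1]]. *)
Lemma cell_contains_end u (z a b : R) : 0 <= z <= 1 -> a <= cell u z <= b ->
  b - a < cw u -> exists2 x, 0 <= x <= 1 & cell u x = a \/ cell u x = b.
Proof.
move=> z01 /andP[az zb] ba.
have [s sw H] := cell_affine eps c_gt0 u.
have p0 := prod_gt0 c_gt0 u.
have s0 : s != 0 by rewrite -normr_gt0 sw.
have E w : cell u (z + (w - cell u z) / s) = w.
  by rewrite H mulrC divfK// addrC subrK.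
set p := (cell u z - a) / `|s|; set q := (b - cell u z) / `|s|.
have ns0 : 0 < `|s| by rewrite sw.
have pp : 0 <= p by rewrite divr_ge0 ?subr_ge0.
have qq : 0 <= q by rewrite divr_ge0 ?subr_ge0.
have pq : p + q < 1.
  by rewrite /p /q -mulrDl ltr_pdivrMr// mul1r sw; lra.
have [ps|ns] := ltP 0 s.
  have Ea : cell u (z - p) = a.
    by rewrite -[RHS]E /p gtr0_norm//; congr cell; field.
  have Eb : cell u (z + q) = b.
    by rewrite -[RHS]E /q gtr0_norm//; congr cell; field.
  have [h|h] := leP 0 (z - p); first by exists (z - p); [lra|left].
  by exists (z + q); [lra|right].
have Ea : cell u (z + p) = a.
  by rewrite -[RHS]E /p ler0_norm//; congr cell; field.
have Eb : cell u (z - q) = b.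
  by rewrite -[RHS]E /q ler0_norm//; congr cell; field.
have [h|h] := leP 0 (z - q); first by exists (z - q); [lra|right].
by exists (z + p); [lra|left].
Qed.

(* Every point between [a] and [b] lies in a cell slightly longer than [b - a],
   which must contain [a] or [b]; apply this to a point where [`|f z - f a|] is
   half the increment of [f]. *)
Lemma steep_cell (M k a b : R) : 0 < k -> (forall i, k <= c i) ->
  (forall x y, 0 <= x <= 1 -> 0 <= y <= 1 -> enorm (f x - f y) <= M) ->
  0 <= a -> a < b -> b <= 1 -> b - a < 1 ->
  exists u y, [/\ 0 <= y <= 1, a <= cell u y <= b, b - a < cw u,
                  k * cw u <= b - a & `|f b - f a| <= 2 * M * lamw u].
Proof.
move=> k0 kc hM a0 ab b1 ba1.
pose g z := `|f z - f a|.
have [z] : exists2 z, z \in `[a, b] & g z = `|f b - f a| / 2.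
  apply: IVT; first exact: ltW.
    have fc : {within `[a, b], continuous f}.
      apply: continuous_subspaceW hf.1 => x /=; rewrite !in_itv/= => /andP[h1 h2].
      by rewrite (le_trans a0)//= (le_trans h2).
    by move=> x; apply: cvg_norm; apply: cvgB; [exact: fc|exact: cvg_cst].
  rewrite /g subrr normr0 ge_min le_max; have := normr_ge0 (f b - f a) => h.
  by apply/andP; split; apply/orP; [left|right]; lra.
rewrite in_itv/= => /andP[az zb] gz.
have [||u [y [y01 zE h1 h2]]] := stopping_cell eps c_gt0 c_sum1 m2 (r := b - a) (x := z) k0 kc.
- by rewrite subr_gt0 ab.
- by rewrite (le_trans a0)//= (le_trans zb).
exists u, y; split => //; first by rewrite -zE az.
have zab : a <= cell u y <= b by rewrite -zE az.
have [x x01 xE] := cell_contains_end y01 zab h1.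
have hx := f_osc u hM y01 x01; rewrite -zE in hx.
have : `|f b - f a| / 2 <= M * lamw u.
  (* Either end serves: by the triangle inequality, [f b] is also at least half the increment away
     from [f z]. *)
  case: xE => xE; rewrite xE in hx; first by rewrite -gz.
  have := ler_normB (f b - f z) (f a - f z).
  have -> : f b - f z - (f a - f z) = f b - f a by rewrite opprB addrA subrK.
  move: gz; rewrite /g (distrC (f z) (f a)) => -> h.
  rewrite (distrC (f b) (f z)) in h; lra.
lra.
Qed.

(** Negating the criterion gives arbitrarily small [h] with increment above [e] times the size of
    [h]; [steep_cell] is applied between [t] and [h + t]. Its inequalities give the constant
    [e * k / (2 * M)]. *)
Lemma nonzero_derivative_cells t : 0 < t < 1 -> ~ zero_derivative_set f t ->
  exists2 e : R, 0 < e & forall n, exists u, [/\ (n <= size u)%N,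
    e * cw u <= lamw u & exists2 y, 0 <= y <= 1 & `|t - cell u y| <= cw u].
Proof.
move=> t01 nD.
have [M M0 hM] := f_bounded.
have [k /andP[k0 k1] kc] := exists_min_gt0 c_gt0.
have [e e0 he] : exists2 e : R, 0 < e & forall n : R, 0 < n -> exists2 h : R, `|h| < n &
    e * `|h| < `|f (h + t) - f t|.
  apply: contrapT => H; apply: nD; apply/zero_derivative_setP; split => // e e0.
  apply: contrapT => H2; apply: H; exists e => // n n0.
  apply: contrapT => H3; apply: H2; exists n => // h hn.
  by rewrite leNgt; apply/negP => h3; apply: H3; exists h.
exists (e * k / (2 * M)); first by rewrite divr_gt0 ?mulr_gt0.
move=> n.
(* The bound [k ^+ n.+1] forces [size u >= n], since [k * k ^+ size u <= k * cw u], which is at most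
   the size of [h]; the other two keep [h + t] in [(0, 1)]. *)
pose r := Num.min (k ^+ n.+1) (Num.min t (1 - t)).
have /andP[t0 t1] := t01.
have r0 : 0 < r by rewrite !lt_min exprn_gt0//= t0 subr_gt0.
have [h] := he r r0; rewrite !lt_min => /and3P[hk ht ht1] hf'.
have h0 : h != 0.
  by apply/eqP => h0; move: hf'; rewrite h0 add0r subrr !normr0 mulr0 ltxx.
move: ht ht1; rewrite !ltr_norml => /andP[h1 h2] /andP[h3 h4].
have h11 : `|h| < 1 by apply: lt_le_trans hk _; rewrite exprn_ile1// ltW.
have [u [y [y01 yab hcw kcw hinc]]] : exists u y, [/\ 0 <= y <= 1,
    `|t - cell u y| <= `|h|, `|h| < cw u, k * cw u <= `|h| &
    `|f (h + t) - f t| <= 2 * M * lamw u].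
  have [hp|hp] := ltP 0 h.
    rewrite (gtr0_norm hp) in h11 *.
    have [||||u [y [y01 /andP[ay yb] q1 q2 q3]]] := @steep_cell M k t (h + t) k0 kc hM.
    - exact: ltW.
    - by rewrite ltrDr.
    - by lra.
    - by lra.
    exists u, y; rewrite addrK in q1 q2; split => //.
    by rewrite ler_distlC; apply/andP; split; lra.
  have hn : h < 0 by rewrite lt_neqAle h0.
  rewrite (ltr0_norm hn) in h11 *.
  have [||||u [y [y01 /andP[ay yb] q1 q2 q3]]] := @steep_cell M k (h + t) t k0 kc hM.
  - by lra.
  - by rewrite gtrDr.
  - by lra.
  - by lra.
  have E : t - (h + t) = - h by ring.
  rewrite E in q1 q2.
  exists u, y; split => //; last by rewrite distrC.
  by rewrite ler_distlC; apply/andP; split; lra.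
exists u; split; last by exists y => //; apply: (le_trans yab); exact: ltW.
  rewrite leqNgt; apply/negP => su.
  have : k * k ^+ size u <= k * cw u by rewrite ler_pM2l//; exact: prod_lower.
  rewrite -exprS => h5.
  have : k ^+ n.+1 <= k ^+ (size u).+1 by apply: ler_wiXn2l => //; [exact: ltW|exact: leqW].
  lra.
rewrite -ler_pdivlMl; last by rewrite divr_gt0// mulr_gt0.
have -> : (e * k / (2 * M))^-1 * lamw u = 2 * M * lamw u / e / k.
  by field; rewrite !gt_eqF.
rewrite !ler_pdivlMr// [leLHS]mulrC mulrA.
apply: le_trans hinc; apply: le_trans (ltW hf').
by rewrite -mulrA mulrC mulrC [cw u * k]mulrC ler_pM2l.
Qed.

(** The ends of a cell containing [t] are within [cw u] of [t], and their images are at Euclidean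
    distance exactly [lamw u]. *)
Lemma zero_derivative_ratio t : zero_derivative_set f t -> forall e, 0 < e ->
  exists2 n : R, 0 < n & forall u y, 0 <= y <= 1 -> t = cell u y -> cw u < n ->
    lamw u <= e * cw u.
Proof.
move=> /zero_derivative_setP[t01 H] e e0.
(* The 2 accounts for both ends of the cell, [d.+1] for the change of norm. *)
pose e' := e / (2 * d.+1%:R).
have e'0 : 0 < e' by rewrite divr_gt0// mulr_gt0.
have [n n0 hn] := H e' e'0; exists n => // u y y01 tE un.
have hx x : 0 <= x <= 1 -> `|f (cell u x) - f t| <= e' * cw u.
  move=> x01; have xt : `|cell u x - t| <= cw u.
    rewrite tE cell_dist// ler_piMr//; first by rewrite ltW// prod_gt0.
    by rewrite ler_distl; apply/andP; split; lra.
  have := hn (cell u x - t); rewrite subrK => /(_ (le_lt_trans xt un)).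
  by move=> /le_trans; apply; rewrite ler_pM2l.
have : enorm (f (cell u 1) - f (cell u 0)) <= d.+1%:R * (e' * cw u + e' * cw u).
  apply: le_trans (enorm_le_norm _) _; rewrite ler_pM2l//.
  have h1 := hx 1 (bool01 true); have h0 := hx 0 (bool01 false).
  have -> : f (cell u 1) - f (cell u 0) =
            (f (cell u 1) - f t) - (f (cell u 0) - f t).
    by rewrite opprB addrA subrK.
  by apply: le_trans (ler_normB _ _) (lerD h1 h0).
rewrite f_cell_enorm ?(bool01 true) ?(bool01 false)// (f_increment false) mulr1.
suff -> : d.+1%:R * (e' * cw u + e' * cw u) = e * cw u by [].
have D0 : d.+1%:R != 0 :> R by rewrite pnatr_eq0.
by rewrite /e'; move: (d.+1%:R) D0 => D D0; field.
Qed.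

(** For small [h], take the cell [U n] just before [k * cw] drops to the size of [h]. The margin [k]
    keeps [t + h] in it, so the increment is at most [M * lamw (U n)]; by [Ub], [cw (U n)] is at
    most the size of [h] divided by [k * b]. *)
Lemma contracting_zero_derivative (U : nat -> seq 'I_m) (k b t : R) :
  U 0%N = [::] -> 0 < k -> 0 < b ->
  (forall n, b * cw (U n) <= cw (U n.+1)) ->
  (forall n, lamw (U n) <= 2^-1 ^+ n * cw (U n)) ->
  (forall e, 0 < e -> exists n, cw (U n) <= e) ->
  (forall n, exists2 y, k <= y <= 1 - k & t = cell (U n) y) ->
  zero_derivative_set f t.
Proof.
move=> U0 k0 b0 Ub Ul Uc tU.
have [M M0 hM] := f_bounded.
have kb0 : 0 < k * b by rewrite mulr_gt0.
apply/zero_derivative_setP; split.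
  by have [y yk] := tU 0%N; rewrite U0 /= => ->; lra.
move=> e e0.
have p0 u : 0 < cw u by exact: prod_gt0.
have [n0 hn0] : exists n, 2^-1 ^+ n <= e * (k * b) / M.
  have h2 : 0 <= (2^-1 : R) < 1 by lra.
  have he : 0 < e * (k * b) / M by rewrite divr_gt0// mulr_gt0.
  by have [N /(_ N (leqnn _))] := exprn_eventually_small h2 he; exists N.
exists (k * cw (U n0)); first by rewrite mulr_gt0.
move=> h hlt.
have [->|h0] := eqVneq h 0; first by rewrite add0r subrr !normr0 mulr0.
pose P n := (n0 < n)%N && (k * cw (U n) <= `|h|).
have exP : exists n, P n.
  have n1 : exists n, (n0 < n)%N /\ k * cw (U n) <= `|h|.
    suff [n [n0n hn]] : exists n, (n0 < n)%N /\ cw (U n) <= `|h| / k.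
      by exists n; split => //; rewrite mulrC -ler_pdivlMr.
    (* The lengths are not assumed monotone: a length below half of each of the first [n0.+1] forces
       an index beyond [n0]. *)
    pose mn := \big[Num.min/`|h| / k]_(i < n0.+1) (cw (U i) / 2).
    have mn0 : 0 < mn.
      apply: lt_bigmin => [|i _]; first by rewrite divr_gt0 ?normr_gt0.
      by rewrite divr_gt0.
    have [n hn] := Uc mn mn0; exists n; split; last first.
      by apply: le_trans hn _; exact: bigmin_le_id.
    rewrite ltnNge; apply/negP => nn0.
    have nS : (n < n0.+1)%N by [].
    have : mn <= cw (U n) / 2.
      exact: (bigmin_le _ (Ordinal nS) (fun i : 'I_n0.+1 => cw (U i) / 2)).
    have := p0 (U n); lra.
  by have [n [h1 h2]] := n1; exists n; apply/andP.
case: (find_ex_minn exP) => -[|n] /andP[n0n hn] nmin; first by [].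
have hUn : `|h| < k * cw (U n).
  move: n0n; rewrite ltnS leq_eqVlt => /predU1P[<-//|n0n].
  rewrite ltNge; apply/negP => hc.
  have /nmin : P n by rewrite /P n0n hc.
  by rewrite ltnn.
have [y yk tE] := tU n.
have [q qE hq] := cell_shift eps c_gt0 (U n) y h.
have qk : `|q| < k by rewrite qE ltr_pdivrMr.
move: qk; rewrite ltr_norml => /andP[qk1 qk2].
rewrite (addrC h) tE hq.
have y01 : 0 <= y <= 1 by lra.
have yq01 : 0 <= y + q <= 1 by lra.
apply: le_trans (f_osc (U n) hM yq01 y01) _.
apply: (@le_trans _ _ (M * (2^-1 ^+ n * cw (U n)))); first by rewrite ler_pM2l.
apply: (@le_trans _ _ (M * (e * (k * b) / M * cw (U n)))).
  rewrite ler_pM2l// ler_pM2r//; apply: le_trans hn0.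
  apply: ler_wiXn2l => //; lra.
have -> : M * (e * (k * b) / M * cw (U n)) = e * (k * (b * cw (U n))).
  by field; rewrite gt_eqF.
rewrite ler_pM2l//; apply: le_trans hn; rewrite ler_pM2l//.
Qed.

(** A zero derivative would force [lamw u] below half of [cw u] on all small cells containing
    [t]. *)
Lemma expanding_nonzero_derivative (U : nat -> seq 'I_m) (t : R) :
  (forall n, cw (U n) <= lamw (U n)) ->
  (forall e, 0 < e -> exists n, cw (U n) <= e) ->
  (forall n, exists2 y, 0 <= y <= 1 & t = cell (U n) y) ->
  ~ zero_derivative_set f t.
Proof.
move=> Ul Uc tU /zero_derivative_ratio H.
have h2 : 0 < (2^-1 : R) by rewrite invr_gt0.
have [n n0 hn] := H _ h2.
have n20 : 0 < n / 2 by rewrite divr_gt0.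
have [N hN] := Uc _ n20.
have [y y01 tE] := tU N.
have h := hn _ _ y01 tE.
have p0 := prod_gt0 c_gt0 (U N).
have := h ltac:(lra); have := Ul N; lra.
Qed.

End SelfAffine.

(** * Separated subsystems of cells and sums over long words *)

Section CellSeparation.
Variables (R : realType) (m : nat) (eps : 'I_m -> bool) (c : 'I_m -> R).
Hypothesis c_gt0 : forall i, 0 < c i.
Hypothesis c_sum1 : \sum_(i < m) c i = 1.
Hypothesis m2 : (2 <= m)%N.

Local Notation cell := (cell eps c).
Local Notation cw u := (\prod_(i <- u) c i).

(** Cell [i] is left of cell [j], hence away from 1. Its left end is the image of 1 if [phi i]
    reverses orientation, and is avoided by subcell [i]; otherwise it is the image of 0, and is
    avoided by subcell [j]. Only the letters [i] and [j] occur, so [v] can be kept among positive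
    ratios. *)
Lemma interior_word (i j : 'I_m) : (i < j)%N -> exists v : seq 'I_m,
  (v = [:: i; i] \/ v = [:: i; j]) /\ exists2 k, 0 < k &
  forall x, 0 <= x <= 1 -> k <= cell v x <= 1 - k.
Proof.
move=> ij; have ci := c_gt0 i; have cj := c_gt0 j.
have ci1 := c_lt1 c_gt0 c_sum1 m2 i; have cj1 := c_lt1 c_gt0 c_sum1 m2 j.
have [bi bi1] := base_itv c_gt0 c_sum1 i.
have [_ bj1] := base_itv c_gt0 c_sum1 j.
have bij := base_mono c_gt0 ij; rewrite baseS in bij.
set B := \sum_(_ < m | _) _ in bi bi1 bij; set B' := \sum_(_ < m | _) _ in bij bj1.
have cij : 0 < c i * c j by rewrite mulr_gt0.
have cij' : c i * c j <= c j by rewrite ger_pMl// ltW.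
have cii : c i * (c i * c j) <= c i * c j by rewrite ger_pMl// ltW.
have cii' : c i * (c i * c j) <= c i * c i by rewrite ler_pM2l// ger_pMr// ltW.
have ciij : 0 < c i * (c i * c j) by rewrite mulr_gt0.
case ei : (eps i).
  exists [:: i; i]; split; first by left.
  exists (c i * (c i * c j)) => // x /andP[x0 x1].
  rewrite /= !phiE ei /= -/B.
  have : 0 <= c i * x by rewrite mulr_ge0// ltW.
  have : 0 <= c i * (1 - x) by rewrite mulr_ge0 ?subr_ge0// ltW.
  set w := B + c i * (1 - x) => h1 h2.
  have w0 : 0 <= w by rewrite addr_ge0.
  have w1 : w <= 1 - c j by rewrite /w; lra.
  have : c i * c j <= c i * (1 - w) by rewrite ler_pM2l//; lra.
  have : 0 <= c i * w by rewrite mulr_ge0// ltW.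
  lra.
exists [:: i; j]; split; first by right.
exists (c i * (c i * c j)) => // x x01.
rewrite /= !(phiE _ _ i) ei /= -/B.
have : c i <= phi eps c j x <= 1.
  have /andP[_ ->] := phi01 eps c_gt0 c_sum1 j x01; rewrite andbT phiE -/B'.
  have : 0 <= c j * (if eps j then 1 - x else x).
    by rewrite mulr_ge0 ?(ltW cj)//; case: (eps j); lra.
  by move: (c j * _) => z ?; lra.
move=> /andP[p0 p1].
have : c i * c i <= c i * phi eps c j x by rewrite ler_pM2l.
have : c i * phi eps c j x <= c i by rewrite ger_pMr.
lra.
Qed.

Lemma cell_interior (k x : R) u : 0 < k -> k <= x <= 1 - k ->
  k * cw u <= cell u x <= 1 - k * cw u.
Proof.
move=> k0 xk; elim: u => [|i u IH]; first by rewrite big_nil mulr1.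
have [b0 b1] := base_itv c_gt0 c_sum1 i; have ci := c_gt0 i.
rewrite big_cons /= phiE mulrCA; move: b0 b1 IH; rewrite -/(cell u x).
set B := \sum_(_ < m | _) _; set X := cell u x; set K := k * cw u => b0 b1 /andP[h1 h2].
have : c i * K <= c i * X by rewrite ler_pM2l.
have : c i * K <= c i * (1 - X) by rewrite ler_pM2l//; lra.
by case: (eps i) => ? ?; lra.
Qed.

(** At the first differing letter [phi_order] applies, the margin having shrunk to at least
    [k * q ^+ size] of the remaining suffix; each common letter costs at most another factor [q]. *)
Lemma cell_separated (k q x y : R) u v : 0 < k -> 0 < q -> (forall i, q <= c i) ->
  size u = size v -> u != v -> k <= x <= 1 - k -> k <= y <= 1 - k ->
  k * q ^+ size u <= `|cell u x - cell v y|.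
Proof.
move=> k0 q0 qc + + xk yk.
elim: u v => [|i u IH] [|j v] //= [suv] uv.
have [ij|ij] := eqVneq i j.
  rewrite -ij phi_dist// exprS mulrCA.
  have uv' : u != v by apply: contra_neq uv => ->; rewrite ij.
  by apply: ler_pM (IH _ suv uv') => //; rewrite ?mulr_ge0 ?exprn_ge0// ltW.
have q1 : q <= 1 by apply: le_trans (qc i) _; exact/ltW/(c_lt1 c_gt0 c_sum1 m2).
have inner w z : size w = size u -> k <= z <= 1 - k ->
    k * q ^+ size u <= cell w z <= 1 - k * q ^+ size u.
  move=> <- zk; have /andP[h1 h2] := cell_interior w k0 zk.
  have : k * q ^+ size w <= k * cw w by rewrite ler_pM2l//; exact: prod_lower.
  by lra.
set K := k * q ^+ size u in inner *.
have K0 : 0 < K by rewrite mulr_gt0// exprn_gt0.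
have iu := inner u x erefl xk; have iv := inner v y (esym suv) yk.
have KE : k * q ^+ (size u).+1 = K * q by rewrite exprSr mulrA.
rewrite KE.
have Kq l : K * q <= K * c l by rewrite ler_pM2l.
have Kc l : 0 < K * c l by rewrite mulr_gt0.
have [lt|gt|/val_inj E] := ltngtP i j; last by rewrite E eqxx in ij.
  have := phi_order eps c_gt0 lt iu iv; rewrite -/(cell u x) -/(cell v y) => h.
  by rewrite distrC ler_normr; apply/orP; left; have := Kq i; have := Kc j; lra.
have := phi_order eps c_gt0 gt iv iu; rewrite -/(cell u x) -/(cell v y) => h.
by rewrite ler_normr; apply/orP; left; have := Kq i; have := Kc j; lra.
Qed.

Lemma foldr_cell (T : Type) (B : T -> seq 'I_m) u y :
  foldr (fun i => cell (B i)) y u = cell (flatten (map B u)) y.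
Proof. by elim: u => //= i u ->; rewrite cell_cat. Qed.

(** Moran's bound for the maps [cell (u ++ v)]: the suffix [v] supplies the margin that
    [cell_separated] requires of distinct words of equal length. *)
Lemma words_lower_bound (W : seq (seq 'I_m)) N v (k s : R) (E : set R) :
  0 < s -> 0 < k -> uniq W -> (forall u, u \in W -> size u = N) -> v != [::] ->
  (forall x, 0 <= x <= 1 -> k <= cell v x <= 1 - k) ->
  1 <= \sum_(u <- W) cw (u ++ v) `^ s ->
  (forall (w : nat -> seq 'I_m) t, (forall n, w n \in W) ->
     (forall n, exists2 y, 0 <= y <= 1 &
        t = cell (flatten (mkseq (fun l => w l ++ v) n)) y) -> E t) ->
  (s%:E <= hausdorff_dim E)%E.
Proof.
move=> s0 k0 uW sW v0 vk sum1 EP.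
have [r /andP[r0 r1] cr] := c_max c_gt0 c_sum1 m2.
have [q /andP[q0 _] qc] := exists_min_gt0 c_gt0.
pose B (i : 'I_(size W)) := nth [::] W i ++ v.
have sB (i : 'I_(size W)) : size (nth [::] W i) = N by apply: sW; exact: mem_nth.
apply: (@moran_lower_bound R (size W) (fun i => cell (B i)) (fun i => cw (B i))
   (fun i x => @cell01 R m eps c c_gt0 c_sum1 (B i) x)
   (fun i x y => cell_dist eps c_gt0 (B i) x y) r (k * q ^+ N) s E) => //.
- by rewrite mulr_gt0// exprn_gt0.
- move=> i; rewrite prod_gt0//=.
  have cr' l : 0 <= c l <= r by rewrite cr ltW.
  have /andP[_ h] := prod_le_exp cr' (B i); apply: le_trans h _.
  rewrite -[leRHS]expr1; apply: ler_wiXn2l => //; first exact: ltW.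
  by rewrite size_cat addn_gt0 orbC lt0n size_eq0 v0.
- move=> i j x y ij x01 y01; rewrite /B !cell_cat -(sB i).
  apply: cell_separated => //; [by rewrite !sB| |exact: vk|exact: vk].
  by rewrite nth_uniq.
- by move: sum1; rewrite (big_nth [::]) big_mkord.
move=> w t H; apply: (EP (fun n => nth [::] W (w n))) => n; first exact: mem_nth.
have [y y01 ->] := H n; exists y => //.
by rewrite foldr_cell /mkseq -map_comp.
Qed.

Let sum_uniq_subset (T : eqType) (s1 s2 : seq T) (P : pred T) (F : T -> R) :
  (forall t, 0 <= F t) -> uniq s1 -> uniq s2 -> {subset s1 <= s2} ->
  \sum_(t <- s1 | P t) F t <= \sum_(t <- s2 | P t) F t.
Proof.
move=> F0 u1 u2 s12.
have -> : \sum_(t <- s1 | P t) F t = \sum_(t <- [seq t <- s2 | t \in s1] | P t) F t.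
  apply: perm_big; apply: uniq_perm; rewrite ?filter_uniq// => t.
  by rewrite mem_filter andb_idr//; exact: s12.
rewrite big_filter_cond [leRHS]big_mkcond/= [leLHS]big_mkcond/=.
by apply: ler_sum => t _; case: (t \in s1) => //=; case: (P t).
Qed.

Let geometric_tail (r : R) a b : 0 <= r < 1 ->
  \sum_(a <= n < b) r ^+ n <= r ^+ a / (1 - r).
Proof.
move=> /andP[r0 r1]; have r1' : 0 < 1 - r by rewrite subr_gt0.
have [ab|ba] := leqP a b; last first.
  by rewrite big_geq ?(ltnW ba)// divr_ge0 ?exprn_ge0// ltW.
rewrite ler_pdivlMr// mulr_suml.
have -> : \sum_(a <= n < b) r ^+ n * (1 - r) = - \sum_(a <= n < b) (r ^+ n.+1 - r ^+ n).
  by rewrite -sumrN; apply: eq_bigr => n _; rewrite exprS; ring.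
by rewrite telescope_sumr// opprB gerBl exprn_ge0.
Qed.

(** Grouping the list by word length bounds the sum by the tail of a geometric series. *)
Lemma sum_long_words (P : pred (seq 'I_m)) (F : seq 'I_m -> R) (C r : R) n0 us :
  (forall u, 0 <= F u) -> 0 <= C -> 0 <= r < 1 ->
  (forall n, \sum_(u <- words (index_enum 'I_m) n | P u) F u <= C * r ^+ n) ->
  uniq us ->
  \sum_(u <- us | (n0 <= size u)%N && P u) F u <= C * (r ^+ n0 / (1 - r)).
Proof.
move=> F0 C0 r01 H uus.
pose L := (\max_(u <- us) size u).+1.
have usL u : u \in us -> (size u < L)%N.
  by move=> uin; rewrite ltnS; exact: leq_bigmax_seq.
apply: le_trans (_ : C * \sum_(n0 <= n < L) r ^+ n <= _); last first.
  by rewrite ler_wpM2l// geometric_tail.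
rewrite mulr_sumr.
apply: le_trans (_ : \sum_(n0 <= n < L) \sum_(u <- us | P u && (size u == n)) F u <= _); last first.
  apply: ler_sum => n _; apply: le_trans (H n).
  have -> : \sum_(u <- us | P u && (size u == n)) F u =
            \sum_(u <- [seq u <- us | size u == n] | P u) F u.
    by rewrite big_filter_cond; apply: eq_bigl => u; rewrite andbC.
  apply: sum_uniq_subset => //; first exact: filter_uniq.
    exact/words_uniq/index_enum_uniq.
  move=> u; rewrite mem_filter mem_words => /andP[-> _] /=.
  by apply/allP => i _; exact: mem_index_enum.
rewrite (exchange_big_dep P)/=; last by move=> n u _ /andP[].
rewrite big_seq_cond [leRHS]big_seq_cond big_mkcond [leRHS]big_mkcond/=.
apply: ler_sum => u _; case: ifPn => [/and3P[uin n0u ->]|_]; last first.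
  by case: ifP => // _; apply: sumr_ge0.
rewrite uin/= big_mkcond/= (bigD1_seq (size u)) ?iota_uniq//=; last first.
  by rewrite mem_index_iota n0u usL.
by rewrite eqxx lerDl sumr_ge0// => n _; case: ifP.
Qed.


End CellSeparation.

(** * Null sets from covers by enlarged cells *)

Section CellCovers.
Variables (R : realType) (m : nat) (eps : 'I_m -> bool) (c : 'I_m -> R).
Hypothesis c_gt0 : forall i, 0 < c i.
Hypothesis c_sum1 : \sum_(i < m) c i = 1.
Hypothesis m2 : (2 <= m)%N.

Local Notation cell := (cell eps c).
Local Notation cw u := (\prod_(i <- u) c i).

(* The cover by cells is completed by the two singletons [0] and [1], indexed by
   [bool]. *)
Lemma cells_null (P : pred (seq 'I_m)) (r s : R) (E : set R) :
  0 < s -> 0 <= r < 1 ->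
  (forall n, \sum_(u <- words (index_enum 'I_m) n | P u) cw u `^ s <= r ^+ n) ->
  (forall t, E t -> t = 0 \/ t = 1 \/ forall n, exists u, [/\ (n <= size u)%N,
     P u & exists2 y, 0 <= y <= 1 & `|t - cell u y| <= cw u]) ->
  hausdorff_measure s E = 0%E.
Proof.
move=> s0 r01 HP HE.
have /andP[r0 r1] := r01.
have r1' : 0 < 1 - r by rewrite subr_gt0.
have [q /andP[q0 q1] cq] := c_max c_gt0 c_sum1 m2.
have cq' i : 0 <= c i <= q by rewrite cq ltW.
have p0 := prod_gt0 c_gt0.
pose J (t : bool + seq 'I_m) : set R := match t with
  | inl b => [set b%:R]
  | inr u => [set x | exists2 y, 0 <= y <= 1 & `|x - cell u y| <= cw u] end.
(* A cell of length [cw u] is enlarged by [cw u] on both sides, hence the factor 3. *)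
pose l (t : bool + seq 'I_m) : R := if t is inr u then 3 * cw u else 0.
apply: (@hausdorff_null R (bool + seq 'I_m)%type J l s E s0).
- by move=> [b|u] //=; rewrite mulr_ge0// ltW.
- move=> [b|u] x x' /=; first by move=> -> ->; rewrite subrr normr0.
  move=> [y y01 hy] [y' y'01 hy'].
  have : `|cell u y - cell u y'| <= cw u.
    rewrite cell_dist// ler_piMr//; first exact: ltW.
    by rewrite ler_distl; apply/andP; split; lra.
  move: hy hy'; rewrite !ler_norml => /andP[? ?] /andP[? ?] /andP[? ?].
  by apply/andP; split; lra.
move=> d e d0 e0.
have q01 : 0 <= q < 1 by rewrite q0.
have d3 : 0 < d / 3 by rewrite divr_gt0.
have [N1 h1] := exprn_eventually_small q01 d3.
have e3 : 0 < e * (1 - r) / 3 `^ s by rewrite divr_gt0 ?mulr_gt0// powR_gt0.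
have [N2 h2] := exprn_eventually_small r01 e3.
pose N := maxn N1 N2.
pose A (t : bool + seq 'I_m) := if t is inr u then (N <= size u)%N && P u else true.
exists A; split.
- move=> [b|u] /=; first by move=> _; exact: ltW.
  move=> /andP[Nu _]; have /andP[_ h] := prod_le_exp cq' u.
  have := h1 (size u) (leq_trans (leq_maxl _ _) Nu); lra.
- move=> t /HE[->|[->|/(_ N)[u [Nu Pu yu]]]].
  + by exists (inl false).
  + by exists (inl true).
  + by exists (inr u) => //=; rewrite Nu.
move=> us uus.
pose F u := if (N <= size u)%N && P u then (3 * cw u) `^ s else 0.
(* The singletons contribute 0 because [s > 0], so only the words are kept. *)
pose proj (t : bool + seq 'I_m) : option (seq 'I_m) := if t is inr u then Some u else None.
have projK : ocancel proj inr by case.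
rewrite big_mkcond/= (eq_bigr (fun t => oapp F 0 (proj t))); last first.
  by move=> [b|u] _ //=; rewrite powR0// gt_eqF.
rewrite -big_pmap -big_mkcond/=.
have u1 : uniq (pmap proj us) by exact: (pmap_uniq projK).
have s30 : 0 < 3 `^ s :> R by rewrite powR_gt0.
have H n : \sum_(u <- words (index_enum 'I_m) n | P u) (3 * cw u) `^ s <= 3 `^ s * r ^+ n.
  under eq_bigr do rewrite powRM ?(ltW (p0 _))//.
  by rewrite -mulr_sumr ler_pM2l.
apply: le_trans (sum_long_words N _ (ltW s30) r01 H u1) _.
  by move=> u; exact: powR_ge0.
have := h2 N (leq_maxr _ _).
by rewrite ler_pdivlMr// -ler_pdivrMr// mulrA [r ^+ N * _]mulrC.
Qed.

End CellCovers.

Lemma powR_expR (R : realType) (a s : R) : 0 < a -> a `^ s = expR (s * ln a).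
Proof. by move=> a0; rewrite /powR gt_eqF. Qed.

(* With [a = - ln u] and [b = ln v], the sum is [u ^ q + v ^ q], where [u < 1 < v]. *)
Lemma two_exponentials (R : realType) (a b : R) : 0 < a -> 0 < b ->
  exists2 k, 1 < k & forall q, k <= expR (- (q * a)) + expR (q * b).
Proof.
move=> a0 b0.
have b2a : 0 < b / (2 * a) by rewrite divr_gt0// mulr_gt0.
have a2b : 0 < a / (2 * b) by rewrite divr_gt0// mulr_gt0.
pose t := Num.min (1 / 2) (Num.min (b / (2 * a)) (a / (2 * b))).
have t0 : 0 < t by rewrite !lt_min b2a a2b !andbT; lra.
have t1 : t <= 1 / 2 by rewrite ge_min lexx.
have t2 : t <= b / (2 * a) by rewrite !ge_min lexx orbT.
have t3 : t <= a / (2 * b) by rewrite !ge_min lexx !orbT.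
exists (1 + t) => [|q]; first by rewrite ltrDl.
have ha := expR_ge1Dx (- (q * a)); have hb := expR_ge1Dx (q * b).
have pa := expR_gt0 (- (q * a)); have pb := expR_gt0 (q * b).
(* For [q >= 0], either the decreasing term is at least [1 / 2] and the other at least 1, or
   [q * b >= b / (2 * a)]. For [q < 0] the roles are exchanged. *)
have [q0|q0] := leP 0 q.
  have [h|h] := leP (q * a) (1 / 2).
    have := mulr_ge0 q0 (ltW b0); lra.
  have : b / (2 * a) <= q * b.
    rewrite ler_pdivrMr ?mulr_gt0//.
    have : 0 <= b * (2 * (q * a) - 1) by rewrite mulr_ge0// ?(ltW b0)//; lra.
    lra.
  lra.
have nq : 0 <= - q by lra.
have [h|h] := leP (- q * b) (1 / 2).
  have := mulr_ge0 nq (ltW a0); lra.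
have : a / (2 * b) <= - q * a.
  rewrite ler_pdivrMr ?mulr_gt0//.
  have : 0 <= a * (2 * (- q * b) - 1) by rewrite mulr_ge0// ?(ltW a0)//; lra.
  lra.
lra.
Qed.

(** * The pressure function *)

Section Pressure.
Variables (R : realType) (m : nat) (lam c : 'I_m -> R).
Hypothesis lam_ge0 : forall i, 0 <= lam i.
Hypothesis c_gt0 : forall i, 0 < c i.
Hypothesis c_lt1 : forall i, c i < 1.

Let x i := ln (lam i / c i).

(* [pressure q s = 1] for [s = q + beta q] *)
Definition pressure (q s : R) : R :=
  \sum_(i < m | 0 < lam i) expR (q * x i) * c i `^ s.

Local Notation lamw u := (\prod_(i <- u) lam i).
Local Notation cw u := (\prod_(i <- u) c i).

(** Letters of ratio 0 are excluded: [ln] takes a real value at 0, so the exponential could not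
    reproduce a zero product. *)
Lemma lamw_expR u : (forall i, i \in u -> 0 < lam i) ->
  lamw u = cw u * expR (\sum_(i <- u) x i).
Proof.
elim: u => [|i u IH] H; first by rewrite !big_nil expR0 mulr1.
rewrite !big_cons expRD IH; last by move=> j ju; apply: H; rewrite inE ju orbT.
have li : 0 < lam i by apply: H; rewrite inE eqxx.
rewrite /x lnK ?posrE ?divr_gt0//.
have := c_gt0 i => ci; field; rewrite ?gt_eqF//.
Qed.

Lemma lamw_gt0 u : 0 < lamw u -> forall i, i \in u -> 0 < lam i.
Proof.
move=> h i iu; rewrite lt_neqAle lam_ge0 andbT eq_sym; apply/eqP => li0.
by move: h; rewrite (big_rem i)//= li0 mul0r ltxx.
Qed.

Lemma prod_powR u s : cw u `^ s = \prod_(i <- u) c i `^ s.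
Proof.
elim: u => [|i u IH]; first by rewrite !big_nil powR1.
by rewrite !big_cons powRM ?IH// ltW// prod_gt0.
Qed.

(** Chernoff's bound: every word in [P] is weighted by a factor at least 1, then the sum is extended
    to all words with positive ratios. *)
Lemma pressure_word_sum (P : pred (seq 'I_m)) q s T n : 0 <= T ->
  (forall u, P u -> 0 < lamw u) ->
  (forall u, P u -> size u = n -> 1 <= T ^+ n * expR (q * \sum_(i <- u) x i)) ->
  \sum_(u <- words (index_enum 'I_m) n | P u) cw u `^ s <= (T * pressure q s) ^+ n.
Proof.
move=> T0 Pl PT; rewrite exprMn /pressure [in leRHS]big_mkcond/= -sum_words mulr_sumr.
rewrite big_seq_cond [leRHS]big_seq big_mkcond/= [leRHS]big_mkcond/=.
apply: ler_sum => u _; case: ifPn => [/andP[uin Pu]|_]; last first.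
  case: ifP => // _; rewrite mulr_ge0 ?exprn_ge0// prodr_ge0// => i _.
  by case: ifP => // _; rewrite mulr_ge0 ?expR_ge0 ?powR_ge0.
rewrite uin.
have su : size u = n by move: uin; rewrite mem_words => /andP[/eqP].
have -> : \prod_(i <- u) (if 0 < lam i then expR (q * x i) * c i `^ s else 0) =
    expR (q * \sum_(i <- u) x i) * cw u `^ s.
  rewrite prod_powR mulr_sumr expR_sum -big_split big_seq [RHS]big_seq.
  by apply: eq_bigr => i iu /=; rewrite (lamw_gt0 (Pl _ Pu) iu).
by rewrite mulrA ler_peMl ?powR_ge0// PT.
Qed.

Lemma pressure_decr q s t : (exists i, 0 < lam i) -> s < t ->
  pressure q t < pressure q s.
Proof.
move=> [j lj] st; rewrite /pressure (bigD1 j)//= [ltRHS](bigD1 j)//=.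
have H i : c i `^ t < c i `^ s.
  rewrite !powR_expR// ltr_expR ltr_nM2r//; apply: ln_lt0.
  by rewrite c_gt0 c_lt1.
apply: ltr_leD; first by rewrite ltr_pM2l ?expR_gt0.
by apply: ler_sum => i _; rewrite ler_pM2l ?expR_gt0// ltW.
Qed.

(** The tangent at [q = 0] of a convex function of [q]; its slope, at [s = 1] or [s = s_hat], is the
    sum whose sign distinguishes the cases. *)
Lemma pressure_ge q s :
  pressure 0 s + q * (\sum_(i < m | 0 < lam i) c i `^ s * x i) <= pressure q s.
Proof.
rewrite /pressure mulr_sumr -big_split; apply: ler_sum => i li /=.
rewrite mul0r expR0 mul1r.
have -> : c i `^ s + q * (c i `^ s * x i) = (1 + q * x i) * c i `^ s by ring.
by rewrite ler_wpM2r ?powR_ge0// expR_ge1Dx.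
Qed.

Lemma pressure0 s : pressure 0 s = \sum_(i < m | 0 < lam i) c i `^ s.
Proof. by apply: eq_bigr => i _; rewrite mul0r expR0 mul1r. Qed.

Lemma pressure_beta (beta : R -> R) q : is_beta lam c beta ->
  pressure q (q + beta q) = 1.
Proof.
move=> /(_ q) <-; apply: eq_bigr => i li.
rewrite !powR_expR// -!expRD; congr expR.
have -> : x i = ln (lam i) - ln (c i) by rewrite /x ln_div// posrE.
by ring.
Qed.

(** The terms of [i] and [j] have exponentials summing to at least some [k > 1] for all [q]; [s] is
    chosen so that the smaller of [c i] and [c j], raised to [s], is [k^-1]. This is what makes
    [beta_star beta 1] positive. *)
Lemma pressure_ge1_all (i j : 'I_m) : 0 < lam i -> lam i < c i -> c j < lam j ->
  exists2 s, 0 < s & forall q, 1 <= pressure q s.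
Proof.
move=> li lci lcj.
have lj : 0 < lam j by apply: lt_trans lcj.
have ij : i != j by apply/eqP => E; move: lcj; rewrite -E ltNge ltW.
have xi : 0 < - x i by rewrite oppr_gt0 ln_lt0// divr_gt0//= ltr_pdivrMr// mul1r.
have xj : 0 < x j by rewrite ln_gt0// ltr_pdivlMr// mul1r.
have [k k1 hk] := two_exponentials xi xj.
pose a := Num.min (c i) (c j).
have a0 : 0 < a by rewrite lt_min !c_gt0.
have a1 : a < 1 by rewrite gt_min c_lt1.
have la : 0 < - ln a by rewrite oppr_gt0 ln_lt0// a0.
have lk : 0 < ln k by rewrite ln_gt0.
pose s := ln k / - ln a.
have s0 : 0 < s by rewrite divr_gt0.
have as1 : a `^ s = k^-1.
  rewrite powR_expR// /s; have -> : ln k / - ln a * ln a = - ln k.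
    by rewrite -mulrA invrN mulNr mulVf ?mulrN1// -oppr_eq0 gt_eqF.
  by rewrite expRN lnK// posrE; lra.
exists s => // q.
rewrite /pressure (bigD1 i)//= (bigD1 j)/=; last by rewrite lj eq_sym.
have rest : 0 <= \sum_(l < m | (0 < lam l) && (l != i) && (l != j))
    expR (q * x l) * c l `^ s.
  by apply: sumr_ge0 => l _; rewrite mulr_ge0 ?expR_ge0 ?powR_ge0.
have ai l : a <= c l -> k^-1 <= c l `^ s.
  move=> al; rewrite -as1 ge0_ler_powR ?nnegrE//; exact: ltW.
have hi : expR (q * x i) * k^-1 <= expR (q * x i) * c i `^ s.
  by rewrite ler_pM2l ?expR_gt0// ai// ge_min lexx.
have hj : expR (q * x j) * k^-1 <= expR (q * x j) * c j `^ s.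
  by rewrite ler_pM2l ?expR_gt0// ai// ge_min lexx orbT.
have := hk q; rewrite mulrN opprK => h.
have : 1 <= (expR (q * x i) + expR (q * x j)) * k^-1.
  by rewrite ler_pdivlMr ?mul1r//; lra.
lra.
Qed.

End Pressure.

(** * Dimension as the infimum [beta_star] *)

Section DimensionFormula.
Variable R : realType.

(** [Q] is the sign condition under which [q] gives an upper bound; other [q] do not lower the
    infimum. A gap below [beta_star] is refuted by the lower bound at its midpoint. *)
Lemma dim_eq_beta_star (E : set R) (beta : R -> R) (Q : R -> Prop) (s0 : R) :
  0 < s0 -> (forall q, s0 <= q + beta q) ->
  (forall q s, Q q -> q + beta q < s -> 0 < s -> hausdorff_measure s E = 0%E) ->
  (forall q, exists2 q', Q q' & q' + beta q' <= q + beta q) ->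
  (forall s, 0 < s -> (forall q, s < q + beta q) -> (s%:E <= hausdorff_dim E)%E) ->
  hausdorff_dim E = beta_star beta 1 /\ (0 < beta_star beta 1)%E.
Proof.
move=> s00 hs0 up QP low.
have sb : (s0%:E <= beta_star beta 1)%E.
  by apply: le_ereal_inf_tmp => _ [q _ <-]; rewrite lee_fin mul1r.
have bp : (0 < beta_star beta 1)%E by apply: lt_le_trans sb; rewrite lte_fin.
split => //; apply/eqP; rewrite eq_le; apply/andP; split.
  apply: le_ereal_inf_tmp => _ [q _ <-]; rewrite mul1r.
  have [q' Qq' q'q] := QP q.
  apply: (@le_trans _ _ (q' + beta q')%:E); last by rewrite lee_fin.
  apply/lee_addgt0Pr => e e0; rewrite -EFinD; apply: hausdorff_dim_le.
    by have := hs0 q'; lra.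
  by apply: (up q') => //; have := hs0 q'; lra.
have bq q : (beta_star beta 1 <= (q + beta q)%:E)%E.
  by apply: ereal_inf_lbound; exists q => //; rewrite mul1r.
have bfin : beta_star beta 1 \is a fin_num.
  by rewrite ge0_fin_numE ?(ltW bp)// (le_lt_trans (bq 0))// ltry.
rewrite leNgt; apply/negP => lt.
have d0 := hausdorff_dim_ge0 E.
have dfin : hausdorff_dim E \is a fin_num.
  by rewrite ge0_fin_numE// (lt_trans lt)// ltey_eq bfin.
move: lt d0 bq low; rewrite -(fineK bfin) -(fineK dfin) lte_fin lee_fin.
set b := fine (beta_star _ _); set D := fine _ => Db D0 bq low.
have := low ((D + b) / 2); rewrite lee_fin => /(_ _ _).
have h1 : 0 < (D + b) / 2 by lra.
have h2 q : (D + b) / 2 < q + beta q.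
  by have := bq q; rewrite lee_fin; lra.
move=> /(_ h1 h2); lra.
Qed.

End DimensionFormula.

(** * Dimension bounds for the two sets *)

Section Dimensions.
Variables (R : realType) (d m : nat) (eps : 'I_m -> bool)
  (S : 'I_m -> 'rV[R]_d.+1 -> 'rV[R]_d.+1) (lam c : 'I_m -> R)
  (f : R -> 'rV[R]_d.+1).
Hypothesis m2 : (2 <= m)%N.
Hypothesis hlam : forall i, 0 <= lam i < 1.
Hypothesis hS : forall i, similitude (S i) (lam i).
Hypothesis hSfirst : forall i : 'I_m, (i : nat) = 0%N ->
  S i (entry R d.+1 (eps i)) = pta R d.+1.
Hypothesis hSlast : forall i : 'I_m, (i : nat).+1 = m ->
  S i (exit R d.+1 (eps i)) = ptb R d.+1.
Hypothesis c_gt0 : forall i, 0 < c i.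
Hypothesis c_sum1 : \sum_(i < m) c i = 1.
Hypothesis hf : self_affine_function eps c S f.

Local Notation cell := (cell eps c).
Local Notation lamw u := (\prod_(i <- u) lam i).
Local Notation cw u := (\prod_(i <- u) c i).
Local Notation x i := (ln (lam i / c i)).

Let lam_ge0 i : 0 <= lam i. Proof. by have /andP[] := hlam i. Qed.

Let lamw_cat u v : lamw (u ++ v) = lamw u * lamw v. Proof. exact: big_cat. Qed.
Let cw_cat u v : cw (u ++ v) = cw u * cw v. Proof. exact: big_cat. Qed.
Let cw_gt0 u : 0 < cw u. Proof. exact: prod_gt0. Qed.

(** The ratios sum to at least 1 and each is below 1. *)
Lemma two_positive_ratios : exists i j : 'I_m, [/\ (i < j)%N, 0 < lam i & 0 < lam j].
Proof.
have sum1 := sum_lam_ge1 m2 hlam hS hSfirst hSlast c_gt0 c_sum1 hf.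
have [i li] : exists i, 0 < lam i.
  apply: contrapT => H; move: sum1; rewrite big1 ?ler10// => i _.
  apply/eqP; rewrite eq_le lam_ge0 andbT leNgt; apply/negP => h; apply: H.
  by exists i.
have [j ji lj] : exists2 j, j != i & 0 < lam j.
  apply: contrapT => H; move: sum1; rewrite (bigD1 i)//= big1 => [|j ji].
    by rewrite addr0 leNgt; have /andP[_ ->] := hlam i.
  apply/eqP; rewrite eq_le lam_ge0 andbT leNgt; apply/negP => h; apply: H.
  by exists j.
have [ij|ij|/val_inj E] := ltngtP i j; last by rewrite E eqxx in ji.
- by exists i, j.
- by exists j, i.
Qed.

Lemma zero_derivative_compl_null (q s : R) : 0 <= q -> 0 < s ->
  pressure lam c q s < 1 ->
  hausdorff_measure s (zero_derivative_compl f) = 0%E.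
Proof.
move=> q0 s0 G1.
have G0 : 0 < pressure lam c q s.
  have [i [_ [_ li _]]] := two_positive_ratios.
  rewrite /pressure (bigD1 i)//= ltr_pwDl//.
    by rewrite mulr_gt0 ?expR_gt0 ?powR_gt0.
  by apply: sumr_ge0 => j _; rewrite mulr_ge0 ?expR_ge0 ?powR_ge0.
set G := pressure _ _ _ _ in G0 G1 *.
have lG : 0 < - ln G by rewrite oppr_gt0 ln_lt0// G0.
(* Small enough for [expR (th * q) * G < 1], yet positive, so that powers of [expR (- th)] absorb
   the constant of [nonzero_derivative_cells]. *)
pose th := - ln G / (2 * (q + 1)).
have q1 : 0 < q + 1 by lra.
have th0 : 0 < th by rewrite divr_gt0 ?mulr_gt0.
have thq : th * q < - ln G.
  have -> : th * q = - ln G * (q / (2 * (q + 1))) by rewrite /th; ring.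
  by rewrite gtr_pMr// ltr_pdivrMr ?mulr_gt0// mul1r; lra.
pose P (u : seq 'I_m) := (0 < lamw u) && (expR (- th) ^+ size u * cw u <= lamw u).
apply: (@cells_null R m eps c c_gt0 c_sum1 m2 P (expR (th * q) * G) s) => //.
- rewrite mulr_ge0 ?expR_ge0 ?(ltW G0)//= -[X in _ * X](lnK G0) -expRD expR_lt1; lra.
- move=> n; apply: pressure_word_sum => //.
  + by move=> u /andP[].
  + move=> u /andP[lu hu] su; rewrite -expRM_natr -expRD -[leLHS]expR0 ler_expR.
    move: hu; rewrite (lamw_expR c_gt0 (lamw_gt0 lam_ge0 lu)) mulrC ler_pM2l//.
    rewrite -expRM_natr ler_expR su => h.
    have : 0 <= q * (\sum_(i <- u) x i - - th * n%:R) by rewrite mulr_ge0 ?subr_ge0.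
    lra.
move=> t [/=]; rewrite in_itv/= => /andP[t0 t1] nD.
have [->|tn0] := eqVneq t 0; first by left.
have [->|tn1] := eqVneq t 1; first by right; left.
right; right => n.
have t01 : 0 < t < 1 by rewrite !lt_neqAle t0 t1 tn1 eq_sym tn0.
have [e e0 he] := nonzero_derivative_cells m2 hlam hS c_gt0 c_sum1 hf t01 nD.
have th1 : 0 <= expR (- th) < 1 by rewrite expR_ge0 expR_lt1 oppr_lt0.
have [N hN] := exprn_eventually_small th1 e0.
have [u [us eu yu]] := he (maxn n N).
move: us; rewrite geq_max => /andP[nu Nu].
exists u; split => //; rewrite /P (lt_le_trans _ eu) ?mulr_gt0//=.
by apply: le_trans eu; rewrite ler_pM2r//; exact: hN.
Qed.

(** Positive ratios are required because a word with a letter of ratio 0 satisfies [lamw u <= cw u]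
    but is absent from the pressure. *)
Lemma zero_derivative_null (q s : R) : (forall i, 0 < lam i) -> q <= 0 -> 0 < s ->
  pressure lam c q s < 1 ->
  hausdorff_measure s (zero_derivative_set f) = 0%E.
Proof.
move=> lam_gt0 q0 s0 G1.
have lu0 u : 0 < lamw u by apply: prod_gt0.
pose P (u : seq 'I_m) := lamw u <= cw u.
apply: (@cells_null R m eps c c_gt0 c_sum1 m2 P (1 * pressure lam c q s) s) => //.
- rewrite mul1r G1 andbT; apply: sumr_ge0 => i _.
  by rewrite mulr_ge0 ?expR_ge0 ?powR_ge0.
- move=> n; apply: pressure_word_sum => // u Pu _.
  rewrite expr1n mul1r -[leLHS]expR0 ler_expR.
  move: Pu; rewrite /P (lamw_expR c_gt0 (fun i _ => lam_gt0 i)).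
  by rewrite ger_pMr// expR_le1 => h; rewrite mulr_le0.
move=> t Dt; right; right => n.
have [t01 _] := (zero_derivative_setP f t).1 Dt.
have [e e0 he] := zero_derivative_ratio m2 hlam hS hSfirst hSlast c_gt0 c_sum1 hf Dt ltr01.
have [r r01 cr] := c_max c_gt0 c_sum1 m2.
have e20 : 0 < e / 2 by rewrite divr_gt0.
have [N hN] := exprn_eventually_small r01 e20.
have t01' : 0 <= t <= 1 by lra.
have [u su [y y01 tE]] := cell_cover eps c_gt0 c_sum1 (maxn n N) t01'.
have cr' i : 0 <= c i <= r by rewrite cr ltW.
have /andP[_ h] := prod_le_exp cr' u.
exists u; split; first by rewrite su leq_maxl.
  rewrite /P -[leRHS]mul1r; apply: (he u y) => //.
  have := hN (size u); rewrite su leq_maxr => /(_ isT); rewrite -su; lra.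
by exists y => //; rewrite tE subrr normr0 ltW.
Qed.

(** Common core of both lower bounds, with [y] the logarithmic ratio or its opposite. [D] is the
    gain demanded of each block [w n ++ v]. *)
Lemma dim_lower_bound (y : 'I_m -> R) (D s : R) (E : set R) : 0 < s ->
  (exists2 i, 0 < lam i & 0 < y i) ->
  (forall q, 0 <= q -> 1 < \sum_(i < m | 0 < lam i) c i `^ s * expR (q * y i)) ->
  (forall v k N (w : nat -> seq 'I_m) t, v != [::] -> 0 < k ->
     (forall z, 0 <= z <= 1 -> k <= cell v z <= 1 - k) ->
     (forall n, size (w n) = N) ->
     (forall n i, i \in w n ++ v -> 0 < lam i) ->
     (forall n, D <= \sum_(i <- w n ++ v) y i) ->
     (forall n, exists2 z, 0 <= z <= 1 &
        t = cell (flatten (mkseq (fun l => w l ++ v) n)) z) -> E t) ->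
  (s%:E <= hausdorff_dim E)%E.
Proof.
move=> s0 [i0 li0 yi0] H EP.
have [i [j [ij li lj]]] := two_positive_ratios.
have [v [vE [k k0 vk]]] := interior_word eps c_gt0 c_sum1 m2 ij.
have vpos l : l \in v -> 0 < lam l.
  by case: vE => ->; rewrite !inE => /orP[] /eqP ->.
have v0 : v != [::] by case: vE => ->.
pose L := [seq l <- index_enum 'I_m | 0 < lam l].
have [|||e e0 cramer] := @cramer_lower_bound R 'I_m L (fun l => c l `^ s) y.
- by move=> l; rewrite powR_gt0.
- by exists i0 => //; rewrite mem_filter li0 mem_index_enum.
- by move=> q q0; rewrite /L big_filter; exact: H.
(* The target compensates the factor that appending [v] brings into the sum. *)
have [N0 hN0] := cramer (cw v `^ s)^-1.
(* The gain left for a word [u] once that of [v] is counted. *)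
pose D' := D - \sum_(l <- v) y l.
pose N1 := Num.bound (`|D'| / e).
have hN1 : `|D'| / e < N1%:R by apply: archi_boundP; rewrite divr_ge0// ltW.
pose N := maxn N0 N1.
have hD' : D' <= e * N%:R.
  apply: le_trans (ler_norm _) _; rewrite mulrC -ler_pdivrMr//.
  by apply: le_trans (ltW hN1) _; rewrite ler_nat leq_maxr.
have hN := hN0 N (leq_maxl _ _).
pose W := [seq u <- words L N | e * N%:R <= \sum_(l <- u) y l].
have WP u : u \in W -> [/\ size u = N, all (mem L) u & e * N%:R <= \sum_(l <- u) y l].
  by rewrite mem_filter mem_words => /and3P[? /eqP ? ?].
apply: (@words_lower_bound R m eps c c_gt0 c_sum1 m2 W N v k s E) => //.
- by rewrite filter_uniq// words_uniq// filter_uniq// index_enum_uniq.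
- by move=> u /WP[].
- rewrite /W big_filter.
  under eq_bigr do rewrite cw_cat powRM ?(ltW (cw_gt0 _))//.
  rewrite -mulr_suml -ler_pdivrMr ?powR_gt0// mul1r.
  rewrite (eq_bigr (fun u => \prod_(l <- u) c l `^ s)) => [|u _]; first exact: hN.
  exact: prod_powR.
move=> w t wW ht; apply: (EP v k N w t) => //.
- by move=> n; have [] := WP _ (wW n).
- move=> n l; rewrite mem_cat => /orP[lw|]; last exact: vpos.
  by have [_ /allP/(_ _ lw)/=] := WP _ (wW n); rewrite mem_filter => /andP[].
- move=> n; have [_ _] := WP _ (wW n); rewrite big_cat/=.
  by move: hD'; rewrite /D'; lra.
Qed.

Let flatten_mkseqS (B : nat -> seq 'I_m) n :
  flatten (mkseq B n.+1) = flatten (mkseq B n) ++ B n.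
Proof. by rewrite mkseqS flatten_rcons. Qed.

Let cw_flatten_small (B : nat -> seq 'I_m) : (forall n, B n != [::]) ->
  forall e, 0 < e -> exists n, cw (flatten (mkseq B n)) <= e.
Proof.
move=> B0 e e0; have [r r01 cr] := c_max c_gt0 c_sum1 m2.
have /andP[r0 r1] := r01.
have [N /(_ N (leqnn _)) hN] := exprn_eventually_small r01 e0.
exists N; apply: le_trans hN.
have cr' i : 0 <= c i <= r by rewrite cr ltW.
have /andP[_ h] := prod_le_exp cr' (flatten (mkseq B N)); apply: le_trans h _.
apply: ler_wiXn2l => //; first exact: ltW.
elim: N => // n IH; rewrite flatten_mkseqS size_cat -addn1 leq_add//.
by rewrite lt0n size_eq0.
Qed.

(** The gain [ln 2] makes every block at least halve the quotient of [lamw] by [cw]. *)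
Lemma zero_derivative_dim_ge (s : R) : (forall i, 0 < lam i) ->
  (exists i, lam i < c i) -> 0 < s ->
  (forall q, q <= 0 -> 1 < pressure lam c q s) ->
  (s%:E <= hausdorff_dim (zero_derivative_set f))%E.
Proof.
move=> lam_gt0 [i0 hi0] s0 G1.
apply: (@dim_lower_bound (fun i => - x i) (ln 2) s) => //.
- exists i0 => //; rewrite oppr_gt0 ln_lt0// divr_gt0//= ltr_pdivrMr// mul1r//.
- move=> q q0; have := G1 (- q); rewrite oppr_le0 => /(_ q0).
  congr (_ < _); apply: eq_bigr => i _.
  by rewrite mulrN mulNr mulrC.
move=> v k N w t v0 k0 vk wN _ hD ht.
have [q /andP[q0 _] qc] := exists_min_gt0 c_gt0.
pose U n := flatten (mkseq (fun l => w l ++ v) n).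
have B0 n : w n ++ v != [::].
  by rewrite -size_eq0 size_cat addn_eq0 !size_eq0 negb_and v0 orbT.
apply: (@contracting_zero_derivative R d m eps S lam c f hlam hS c_gt0 c_sum1 hf
  U (k * q ^+ N) (q ^+ (N + size v)) t) => //.
- by rewrite mulr_gt0// exprn_gt0.
- by rewrite exprn_gt0.
- move=> n; rewrite /U flatten_mkseqS [in leRHS]cw_cat mulrC ler_pM2l//.
  by rewrite -(wN n) -size_cat; exact: prod_lower.
- elim=> [|n IH]; first by rewrite /U /= !big_nil expr0 mulr1.
  rewrite {1 2}/U flatten_mkseqS lamw_cat cw_cat exprSr.
  have hB : lamw (w n ++ v) <= 2^-1 * cw (w n ++ v).
    rewrite (lamw_expR c_gt0 (fun i _ => lam_gt0 i)) mulrC ler_pM2r//.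
    rewrite -[leRHS]lnK ?posrE ?invr_gt0// ler_expR lnV ?posrE//.
    have := hD n; rewrite sumrN; lra.
  have -> : 2^-1 ^+ n * 2^-1 * (cw (flatten (mkseq (fun l => w l ++ v) n)) * cw (w n ++ v)) =
    (2^-1 ^+ n * cw (U n)) * (2^-1 * cw (w n ++ v)) by rewrite /U; ring.
  by apply: ler_pM => //; rewrite ltW// prod_gt0.
- exact: cw_flatten_small.
(* The next block ends in [v], so [t] keeps the margin [k * cw (w n)], at least [k * q ^+ N], in the
   coordinate of the cell of [U n]. *)
move=> n; have [z z01] := ht n.+1.
rewrite flatten_mkseqS !cell_cat => tE; exists (cell (w n) (cell v z)) => //.
have := cell_interior eps c_gt0 c_sum1 (w n) k0 (vk z z01).
have : k * q ^+ N <= k * cw (w n).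
  by rewrite ler_pM2l// -(wN n); exact: prod_lower.
lra.
Qed.

(** Gain 0 is enough: no block lowers the quotient of [lamw] by [cw]. *)
Lemma zero_derivative_compl_dim_ge (s : R) : ~ (forall i, lam i = c i) -> 0 < s ->
  (forall q, 0 <= q -> 1 < pressure lam c q s) ->
  (s%:E <= hausdorff_dim (zero_derivative_compl f))%E.
Proof.
move=> hlamc s0 G1.
have [i0 hi0] := exists_lam_gt m2 hlam hS hSfirst hSlast c_gt0 c_sum1 hf hlamc.
apply: (@dim_lower_bound (fun i => x i) 0 s) => //.
- exists i0; first exact: lt_trans hi0.
  by rewrite ln_gt0// ltr_pdivlMr// mul1r.
- move=> q q0; have := G1 q q0.
  by congr (_ < _); apply: eq_bigr => i _; rewrite mulrC.
move=> v k N w t v0 k0 vk wN wpos hD ht.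
pose U n := flatten (mkseq (fun l => w l ++ v) n).
have B0 n : w n ++ v != [::].
  by rewrite -size_eq0 size_cat addn_eq0 !size_eq0 negb_and v0 orbT.
split.
  have [z z01 ->] := ht 0%N; rewrite /= in_itv/=; exact: z01.
apply: (@expanding_nonzero_derivative R d m eps S lam c f m2 hlam hS hSfirst hSlast
  c_gt0 c_sum1 hf U t) => //.
- elim=> [|n IH]; first by rewrite /U /= !big_nil.
  rewrite {1 2}/U flatten_mkseqS lamw_cat cw_cat.
  apply: ler_pM => //; [exact: ltW|exact: ltW|].
  rewrite (lamw_expR c_gt0 (wpos n)) ler_peMr ?(ltW (cw_gt0 _))//.
  by rewrite -[leLHS]expR0 ler_expR.
- exact: cw_flatten_small.
Qed.

End Dimensions.

(** * The three dimension formulas *)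

Theorem theorem2p6 (R : realType) (d m : nat) (hm : (2 <= m)%N)
  (eps : 'I_m -> bool) (S : 'I_m -> 'rV[R]_d.+1 -> 'rV[R]_d.+1)
  (lam c : 'I_m -> R)
  (hlam : forall i, 0 <= lam i < 1)
  (hlam2 : m = 2%N -> forall i, 0 < lam i)
  (hS : forall i, similitude (S i) (lam i))
  (hSfirst : forall i : 'I_m, (i : nat) = 0%N ->
     S i (entry R d.+1 (eps i)) = pta R d.+1)
  (hSlast : forall i : 'I_m, (i : nat).+1 = m ->
     S i (exit R d.+1 (eps i)) = ptb R d.+1)
  (hSchain : forall i j : 'I_m, (i : nat).+1 = j ->
     S i (exit R d.+1 (eps i)) = S j (entry R d.+1 (eps j)))
  (hc : forall i, 0 < c i)
  (hcsum : \sum_(i < m) c i = 1)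
  (hlamc : ~ (forall i, lam i = c i))
  (f : R -> 'rV[R]_d.+1)
  (hf : self_affine_function eps c S f)
  (s_hat : R) (hs0 : 0 <= s_hat)
  (hs : \sum_(i < m | 0 < lam i) c i `^ s_hat = 1)
  (beta : R -> R) (hbeta : is_beta lam c beta)
  (hlt : exists i, lam i < c i) :
  [/\ ((0 <= \sum_(i < m) (c i)%:E * lne (lam i / c i)%:E)%E ->
        hausdorff_dim (zero_derivative_set f) = beta_star beta 1 /\
        (0 < beta_star beta 1)%E),
      (0 <= \sum_(i < m | (0 < lam i)%R) c i `^ s_hat * ln (lam i / c i) ->
        hausdorff_dim (zero_derivative_compl f) = s_hat%:E /\
        0 < s_hat)
    & (\sum_(i < m | (0 < lam i)%R) c i `^ s_hat * ln (lam i / c i) < 0 ->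
        hausdorff_dim (zero_derivative_compl f) = beta_star beta 1 /\
        (0 < beta_star beta 1)%E)].
Proof.
have lam_ge0 i : 0 <= lam i by have /andP[] := hlam i.
have [p1 [p2 [p12 lp1 lp2]]] :=
  two_positive_ratios hm hlam hS hSfirst hSlast hc hcsum hf.
have lpos : exists i, 0 < lam i by exists p1.
have c1 := c_lt1 hc hcsum hm.
have [jb hjb] := exists_lam_gt hm hlam hS hSfirst hSlast hc hcsum hf hlamc.
(* By monotonicity, comparing [s] with [q + beta q] amounts to comparing [pressure lam c q s] with
   1. *)
have decr q s t := @pressure_decr R m lam c hc c1 q s t lpos.
have Gb q : pressure lam c q (q + beta q) = 1 by exact: pressure_beta.
have Glt q s : q + beta q < s -> pressure lam c q s < 1.
  by rewrite -(Gb q); exact: decr.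
have Ggt q s : s < q + beta q -> 1 < pressure lam c q s.
  by rewrite -(Gb q); exact: decr.
have leb q s : 1 <= pressure lam c q s -> s <= q + beta q.
  by move=> h; rewrite leNgt; apply/negP => /Glt; rewrite ltNge h.
have geb q s : pressure lam c q s <= 1 -> q + beta q <= s.
  by move=> h; rewrite leNgt; apply/negP => /Ggt; rewrite ltNge h.
have G0s : pressure lam c 0 s_hat = 1 by rewrite pressure0.
split.
- move=> h.
  (* A zero ratio would make the extended sum [-oo]. *)
  have lam_gt0 i : 0 < lam i.
    rewrite lt_neqAle lam_ge0 andbT eq_sym; apply/eqP => li0.
    have /esum_eqNyP E : exists j : 'I_m, [/\ j \in index_enum 'I_m, true &
        ((c j)%:E * lne (lam j / c j)%:E)%E = -oo%E].
      exists i; split; rewrite ?mem_index_enum//.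
      by rewrite li0 mul0r le0_lneNy// mulrNy gtr0_sg// mul1e.
    by move: h; rewrite E.
  have sum0 : 0 <= \sum_(i < m | 0 < lam i) c i `^ 1 * ln (lam i / c i).
    move: h; under eq_bigr do rewrite lne_EFin ?divr_gt0// -EFinM.
    rewrite sumEFin lee_fin; congr (_ <= _).
    by apply: eq_big => [i|i _]; rewrite ?lam_gt0// powRr1// ltW.
  have G01 : pressure lam c 0 1 = 1.
    rewrite pressure0 -[RHS]hcsum.
    by apply: eq_big => [i|i _]; rewrite ?lam_gt0// powRr1// ltW.
  have [i hi] := hlt.
  have [s0 s00 hs0'] := pressure_ge1_all hc c1 (lam_gt0 i) hi hjb.
  apply: (@dim_eq_beta_star R _ beta (fun q => q <= 0) s0) => //.
  + by move=> q; exact: leb.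
  + move=> q s q0 qs sp; apply: (zero_derivative_null hm hlam hS hSfirst hSlast hc hcsum hf lam_gt0 q0 sp).
    exact: Glt.
  (* For [q > 0] the tangent at 0 has nonnegative slope, so [pressure lam c q 1 >= 1]: [q + beta q]
     is at least 1, which bounds [beta 0]. *)
  + move=> q; have [q0|q0] := leP q 0; first by exists q.
    exists 0 => //; apply: (@le_trans _ _ 1); first by apply: geb; rewrite G01.
    apply: leb; apply: le_trans (pressure_ge _ _ q 1).
    by rewrite G01 lerDl mulr_ge0// ltW.
  + move=> s sp sb; apply: (zero_derivative_dim_ge hm hlam hS hSfirst hSlast hc hcsum hf) => //.
    by move=> q _; exact: Ggt.
- move=> sum0.
  (* At exponent 0 the sum would count the positive ratios, of which there are at least two. *)
  have s_gt0 : 0 < s_hat.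
    rewrite lt_neqAle hs0 andbT eq_sym; apply/eqP => s0.
    move: hs; rewrite s0 (bigD1 p1)//= (bigD1 p2)/=; last first.
      by rewrite lp2/= -val_eqE gtn_eqF.
    rewrite !powRr0 => E.
    have : 0 <= \sum_(i < m | (0 < lam i) && (i != p1) && (i != p2)) c i `^ 0.
      by apply: sumr_ge0 => i _; exact: powR_ge0.
    lra.
  split => //; apply/eqP; rewrite eq_le; apply/andP; split.
    apply/lee_addgt0Pr => e e0; rewrite -EFinD; apply: hausdorff_dim_le; first lra.
    apply: (zero_derivative_compl_null hm hlam hS hSfirst hSlast hc hcsum hf (lexx 0)).
      lra.
    by rewrite -G0s; apply: decr; lra.
  rewrite leNgt; apply/negP => lt.
  have d0 := hausdorff_dim_ge0 (zero_derivative_compl f).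
  have dfin : hausdorff_dim (zero_derivative_compl f) \is a fin_num.
    by rewrite ge0_fin_numE// (lt_trans lt)// ltry.
  move: lt d0; rewrite -(fineK dfin) lte_fin lee_fin => lt d0.
  pose s := (fine (hausdorff_dim (zero_derivative_compl f)) + s_hat) / 2.
  have sp : 0 < s by rewrite /s; lra.
  have ss : s < s_hat by rewrite /s; lra.
  (* The tangent at 0 keeps the pressure at [s_hat] at least 1; it is strictly larger at
     [s < s_hat]. *)
  have H q : 0 <= q -> 1 < pressure lam c q s.
    move=> q0; apply: le_lt_trans (decr q _ _ ss).
    apply: le_trans (pressure_ge _ _ q s_hat).
    by rewrite G0s lerDl mulr_ge0.
  have := zero_derivative_compl_dim_ge hm hlam hS hSfirst hSlast hc hcsum hf hlamc sp H.
  rewrite -(fineK dfin) lee_fin /s; lra.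
- move=> sum0.
  (* The index given by [hlt] may have ratio 0; the negative sum yields one with positive ratio. *)
  have [i li hi] : exists2 i, 0 < lam i & lam i < c i.
    apply: contrapT => H; move: sum0; rewrite ltNge => /negP; apply.
    apply: sumr_ge0 => i li; rewrite mulr_ge0 ?powR_ge0// ln_ge0//.
    rewrite ler_pdivlMr// mul1r leNgt; apply/negP => hi.
    by apply: H; exists i.
  have [s0 s00 hs0'] := pressure_ge1_all hc c1 li hi hjb.
  apply: (@dim_eq_beta_star R _ beta (fun q => 0 <= q) s0) => //.
  + by move=> q; exact: leb.
  + move=> q s q0 qs sp.
    apply: (zero_derivative_compl_null hm hlam hS hSfirst hSlast hc hcsum hf q0 sp).
    exact: Glt.
  (* For [q < 0] the negative slope raises the tangent above 1, so [q + beta q] is at least [s_hat],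
     which bounds [beta 0]. *)
  + move=> q; have [q0|q0] := leP 0 q; first by exists q.
    exists 0 => //; apply: (@le_trans _ _ s_hat); first by apply: geb; rewrite G0s.
    apply: leb; apply: le_trans (pressure_ge _ _ q s_hat).
    by rewrite G0s lerDl; apply: mulr_le0; exact: ltW.
  + move=> s sp sb.
    apply: (zero_derivative_compl_dim_ge hm hlam hS hSfirst hSlast hc hcsum hf) => //.
    by move=> q _; exact: Ggt.
Qed.
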